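(* $\mathsf{RCA}_0^{\ast}$ proves: for all $a,c\in\mathbb{N}$ that are not both $0$, $wr_c(a)=a^c$.
   Context: $\mathsf{RCA}_0^{\ast}$ is the subsystem of second order arithmetic, in the usual language augmented by a binary function symbol $\exp$ (written $m^n$), whose axioms are: the basic axioms of second order arithmetic (the usual quantifier-free axioms for $0,1,+,\cdot,<$); the exponentiation axioms $m^0=1$, $m^{n+1}=m\cdot m^n$; the induction scheme for all $\Sigma^0_0$ formulas (possibly containing $\exp$); and the comprehension scheme for all $\Delta^0_1$ formulas (possibly containing $\exp$). $\mathbb{N}$ is the set of nonnegative integers, and $c\in\mathbb{N}$ is identified with $\{0,\dots,c-1\}$. For $R\in\mathbb{N}$, $[0,R]=\{n\in\mathbb{N}:n\le R\}$ and $[0,R]^2=\{(n,m)\in\mathbb{N}^2:0\le n<m\le R\}$. For a coloring $C\colon[0,R]^2\to c$, a set $H=\{h_0<h_1<\cdots\}\subseteq[0,R]$ is $C$-weakly homogeneous if $C(h_i,h_{i+1})=C(h_{i+1},h_{i+2})$ for all $h_i,h_{i+1},h_{i+2}\in H$. The weak Ramsey number $wr_c(a)$ is the smallest $R$ such that for every coloring $C\colon[0,R]^2\to c$ there exists a $C$-weakly homogeneous set $H$ with $|H|=a+1$. *)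

(* Defs.v *)
From Stdlib Require Import List.
Import ListNotations.

(* Two-sorted first-order language of second order arithmetic with exp.
   Number and set variables are two separate families of de Bruijn indices;
   as usual, set terms are set variables and equality is between numbers
   only. *)

Inductive term : Type :=
| Var (i : nat)
| Zero
| One
| Plus (s t : term)
| Times (s t : term)
| Exp (s t : term).

Inductive form : Type :=
| Equal (s t : term)
| Less (s t : term)
| Mem (t : term) (X : nat)
| Bot
| Imp (A B : form)
| All (A : form)     (* over numbers: binds number index 0 *)
| AllS (A : form).   (* over sets: binds set index 0 *)

Fixpoint tsubst (sigma : nat -> term) (t : term) : term :=
  match t with
  | Var i => sigma i
  | Zero => Zero
  | One => One
  | Plus s t => Plus (tsubst sigma s) (tsubst sigma t)
  | Times s t => Times (tsubst sigma s) (tsubst sigma t)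
  | Exp s t => Exp (tsubst sigma s) (tsubst sigma t)
  end.

(* [lift k t] is the term t placed under k additional number binders. *)
Definition lift (k : nat) (t : term) : term := tsubst (fun i => Var (k + i)) t.

Definition scons {T : Type} (x : T) (f : nat -> T) (i : nat) : T :=
  match i with 0 => x | S j => f j end.

Definition up (sigma : nat -> term) : nat -> term :=
  scons (Var 0) (fun i => lift 1 (sigma i)).

Fixpoint subst (sigma : nat -> term) (A : form) : form :=
  match A with
  | Equal s t => Equal (tsubst sigma s) (tsubst sigma t)
  | Less s t => Less (tsubst sigma s) (tsubst sigma t)
  | Mem t X => Mem (tsubst sigma t) X
  | Bot => Bot
  | Imp A B => Imp (subst sigma A) (subst sigma B)
  | All A => All (subst (up sigma) A)
  | AllS A => AllS (subst sigma A)
  end.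

Fixpoint srename (rho : nat -> nat) (A : form) : form :=
  match A with
  | Equal s t => Equal s t
  | Less s t => Less s t
  | Mem t X => Mem t (rho X)
  | Bot => Bot
  | Imp A B => Imp (srename rho A) (srename rho B)
  | All A => All (srename rho A)
  | AllS A => AllS (srename (scons 0 (fun i => S (rho i))) A)
  end.

Definition inst (t : term) (A : form) : form := subst (scons t Var) A.
Definition instS (X : nat) (A : form) : form := srename (scons X (fun i => i)) A.
Definition shift (A : form) : form := subst (fun i => Var (S i)) A.
Definition shiftS (A : form) : form := srename S A.

Definition Neg (A : form) : form := Imp A Bot.
Definition And (A B : form) : form := Neg (Imp A (Neg B)).
Definition Or (A B : form) : form := Imp (Neg A) B.
Definition Iff (A B : form) : form := And (Imp A B) (Imp B A).
Definition Ex (A : form) : form := Neg (All (Neg A)).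
Definition ExS (A : form) : form := Neg (AllS (Neg A)).
Definition LessEq (s t : term) : form := Or (Less s t) (Equal s t).

Declare Scope l2term_scope.
Delimit Scope l2term_scope with tm.
Bind Scope l2term_scope with term.
Declare Scope l2form_scope.
Delimit Scope l2form_scope with fm.
Bind Scope l2form_scope with form.

Notation "# i" := (Var i) (at level 1, format "# i") : l2term_scope.
Notation "0" := Zero : l2term_scope.
Notation "1" := One : l2term_scope.
Notation "s + t" := (Plus s t) : l2term_scope.
Notation "s * t" := (Times s t) : l2term_scope.
Notation "s ^ t" := (Exp s t) : l2term_scope.
Notation "s = t" := (Equal s%tm t%tm) : l2form_scope.
Notation "s < t" := (Less s%tm t%tm) : l2form_scope.
Notation "s <= t" := (LessEq s%tm t%tm) : l2form_scope.
Notation "t \in X" := (Mem t%tm X%nat) (at level 70, no associativity) : l2form_scope.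
Notation "A -> B" := (Imp A B) : l2form_scope.
Notation "A <-> B" := (Iff A B) : l2form_scope.
Notation "A /\ B" := (And A B) : l2form_scope.
Notation "A \/ B" := (Or A B) : l2form_scope.
Notation "~ A" := (Neg A) : l2form_scope.

(* Classical natural deduction over a set T of nonlogical axioms. Free
   variables of the members of T are read universally: the generalization
   rules restrict the variables of the hypotheses G only. *)
Inductive derives (T : form -> Prop) : list form -> form -> Prop :=
| d_axiom G A : T A -> derives T G A
| d_hyp G A : In A G -> derives T G A
| d_impI G A B : derives T (A :: G) B -> derives T G (Imp A B)
| d_impE G A B : derives T G (Imp A B) -> derives T G A -> derives T G B
| d_raa G A : derives T (Neg A :: G) Bot -> derives T G A
| d_allI G A : derives T (map shift G) A -> derives T G (All A)
| d_allE G A t : derives T G (All A) -> derives T G (inst t A)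
| d_allSI G A : derives T (map shiftS G) A -> derives T G (AllS A)
| d_allSE G A X : derives T G (AllS A) -> derives T G (instS X A)
| d_refl G t : derives T G (Equal t t)
| d_leibniz G s t A :
    derives T G (Equal s t) -> derives T G (inst s A) -> derives T G (inst t A).

Definition proves (T : form -> Prop) (A : form) : Prop := derives T [] A.

(* The remaining connectives and the bounded existential quantifier are the
   classical abbreviations of those generated here. The bound t does not
   contain the quantified variable. *)
Inductive Sigma00 : form -> Prop :=
| s00_eq s t : Sigma00 (Equal s t)
| s00_lt s t : Sigma00 (Less s t)
| s00_mem t X : Sigma00 (Mem t X)
| s00_bot : Sigma00 Bot
| s00_imp A B : Sigma00 A -> Sigma00 B -> Sigma00 (Imp A B)
| s00_ball t A : Sigma00 A -> Sigma00 (All (Imp (Less (Var 0) (lift 1 t)) A)).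

Definition Sigma01 (A : form) : Prop := exists B, Sigma00 B /\ A = Ex B.
Definition Pi01 (A : form) : Prop := exists B, Sigma00 B /\ A = All B.

(* In both schemes the distinguished number variable n is index 0 of A;
   all other free variables are parameters. *)
Definition induction_axiom (A : form) : form :=
  (inst 0 A /\ All (A -> subst (scons (#0 + 1)%tm (fun i => #(S i))%tm) A)
   -> All A)%fm.

(* [shiftS] keeps the set being defined from occurring in A. *)
Definition comprehension_axiom (A B : form) : form :=
  (All (A <-> B) -> ExS (All (#0 \in 0 <-> shiftS A)))%fm.

Inductive RCA0star : form -> Prop :=
| ax_succ_nonzero : RCA0star (~ (#0 + 1 = 0))%fm
| ax_succ_inj : RCA0star (#0 + 1 = #1 + 1 -> #0 = #1)%fm
| ax_add_zero : RCA0star (#0 + 0 = #0)%fm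
| ax_add_succ : RCA0star (#0 + (#1 + 1) = (#0 + #1) + 1)%fm
| ax_mul_zero : RCA0star (#0 * 0 = 0)%fm
| ax_mul_succ : RCA0star (#0 * (#1 + 1) = #0 * #1 + #0)%fm
| ax_lt_zero : RCA0star (~ (#0 < 0))%fm
| ax_lt_succ : RCA0star (#0 < #1 + 1 <-> #0 < #1 \/ #0 = #1)%fm
| ax_exp_zero : RCA0star (#0 ^ 0 = 1)%fm
| ax_exp_succ : RCA0star (#0 ^ (#1 + 1) = #0 * #0 ^ #1)%fm
| ax_induction A : Sigma00 A -> RCA0star (induction_axiom A)
| ax_comprehension A B :
    Sigma01 A -> Pi01 B -> RCA0star (comprehension_axiom A B).

(* The usual pairing of second order arithmetic, (s,t) = (s+t)^2 + s.
   Functions are represented by their graphs. *)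
Definition opair (s t : term) : term := ((s + t) * (s + t) + s)%tm.

(* C is a function from [0,R]^2 to c:
   every z in C is ((x,y),k) with x < y <= R and k < c;
   each x < y <= R has a value k; and the value is unique. *)
Definition coloring (C : nat) (R c : term) : form :=
  ( All (#0 \in C ->
      Ex (Ex (Ex (#2 < #1 /\ #1 <= lift 4 R /\ #0 < lift 4 c
                  /\ #3 = opair (opair #2 #1) #0))))
  /\ All (All (#1 < #0 /\ #0 <= lift 2 R -> Ex (opair (opair #2 #1) #0 \in C)))
  /\ All (All (All (All
      (opair (opair #3 #2) #1 \in C /\ opair (opair #3 #2) #0 \in C
       -> #1 = #0)))))%fm.

(* H = {h_0 < ... < h_(n-1)}, hence |H| = n:
   h is a function from n to H; it is onto H; it is strictly increasing. *)
Definition enumerates (h H : nat) (n : term) : form :=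
  ( All (#0 \in h -> Ex (Ex (#1 < lift 3 n /\ #0 \in H /\ #2 = opair #1 #0)))
  /\ All (#0 < lift 1 n -> Ex (opair #1 #0 \in h))
  /\ All (All (All (opair #2 #1 \in h /\ opair #2 #0 \in h -> #1 = #0)))
  /\ All (#0 \in H -> Ex (opair #0 #1 \in h))
  /\ All (All (All (All
      (#3 < #2 /\ opair #3 #1 \in h /\ opair #2 #0 \in h -> #1 < #0)))))%fm.

(* Here h enumerates H as above: C(h_i,h_(i+1)) = C(h_(i+1),h_(i+2)) whenever
   h_i, h_(i+1), h_(i+2) exist;
   the quantified variables are i, x = h_i, y = h_(i+1), z = h_(i+2) and then
   the common color. *)
Definition weakly_homogeneous (C h : nat) : form :=
  All (All (All (All
    (opair #3 #2 \in h /\ opair (#3 + 1) #1 \in h /\ opair (#3 + 1 + 1) #0 \in h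
     -> Ex (opair (opair #3 #2) #0 \in C /\ opair (opair #2 #1) #0 \in C)))))%fm.

(* Every coloring C : [0,R]^2 -> c has a C-weakly homogeneous H, a subset of
   [0,R], with |H| = a + 1. Inside, the set variables C, H, h have indices
   2, 1, 0. *)
Definition weak_ramsey (R c a : term) : form :=
  AllS (coloring 0 R c ->
    ExS (ExS (All (#0 \in 1 -> #0 <= lift 1 R)
              /\ enumerates 0 1 (a + 1)
              /\ weakly_homogeneous 2 0)))%fm.

(* w = wr_c(a) *)
Definition is_wr (w c a : term) : form :=
  ( weak_ramsey w c a
  /\ All (#0 < lift 1 w -> ~ weak_ramsey #0 (lift 1 c) (lift 1 a)))%fm.

(* Main.v *)
(* By Henkin's completeness theorem for the two-sorted calculus it suffices to prove
   wr_c(a) = a^c in every structure satisfying RCA0star. There, digit expansions in base b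
   code finite sequences, and induction is applied only to relations defined by Sigma00
   formulas with parameters.
   Upper bound: if no color has a path h_0 < ... < h_a, send n <= a^c to the number below a^c
   whose k-th base-a digit is the length of the longest path of color k ending at n; an edge
   of color k makes the k-th digit grow, so this map is injective, against the pigeonhole
   principle.
   Lower bound: color x < y < a^c by the position k of the most significant base-a digit at
   which they differ; along a path of color k the quotient by a^(k+1) is constant while the
   k-th digit strictly increases, so the path has fewer than a edges. *)

From Stdlib Require Import List Arith Lia Ring Cantor Classical ClassicalEpsilon.
From Stdlib Require Import FunctionalExtensionality PropExtensionality ProofIrrelevance.
Require Import Defs.
Import ListNotations.

(** * Substitution *)

(** A structure satisfying the axioms may be nonstandard and has induction for bounded formulas
    only, so functions cannot be iterated inside it, and the pigeonhole principle itself has to be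
    proved there. Every auxiliary finite object is therefore a single number below an explicit
    power: a path with l edges in [0, R] lies below (R + 1)^(l + 1), a vector of c lengths below
    a^c. Exponentiation thus turns quantifiers over such objects into bounded ones, and bounds such
    as q <= n or x <= R in definitions and induction statements serve the same end. The exclusion of
    a = c = 0 comes from 0^0 = 1: a single vertex is weakly homogeneous, so wr_0(0) = 0. If only a
    is 0, then a^c = 0 is right; if only c is 0, then a^0 = 1 is right, since [0, 0] has no pairs to
    color while [0, 1] has no coloring at all. *)

Lemma tsubst_comp sigma tau t :
  tsubst tau (tsubst sigma t) = tsubst (fun i => tsubst tau (sigma i)) t.
Proof. induction t; simpl; congruence. Qed.

Lemma tsubst_var t : tsubst Var t = t.
Proof. induction t; simpl; congruence. Qed.

Lemma tsubst_scons_lift u sigma t : tsubst (scons u sigma) (lift 1 t) = tsubst sigma t.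
Proof. unfold lift. now rewrite tsubst_comp. Qed.

Lemma tsubst_up_lift sigma t : tsubst (up sigma) (lift 1 t) = lift 1 (tsubst sigma t).
Proof. unfold lift. now rewrite !tsubst_comp. Qed.

Lemma up_comp sigma tau :
  (fun i => tsubst (up tau) (up sigma i)) = up (fun i => tsubst tau (sigma i)).
Proof.
  extensionality i. destruct i as [|i]; [easy|]. apply tsubst_up_lift.
Qed.

Lemma up_var : up Var = Var.
Proof. extensionality i. now destruct i. Qed.

Lemma subst_comp A : forall sigma tau,
  subst tau (subst sigma A) = subst (fun i => tsubst tau (sigma i)) A.
Proof.
  induction A as [| | | |A IHA B IHB|A IHA|A IHA]; intros sigma tau; simpl;
    rewrite ?tsubst_comp, ?IHA, ?IHB, ?up_comp; reflexivity.
Qed.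

Lemma subst_var A : subst Var A = A.
Proof.
  induction A; simpl; rewrite ?tsubst_var, ?up_var; congruence.
Qed.

Definition sup (rho : nat -> nat) : nat -> nat := scons 0 (fun i => S (rho i)).

Lemma srename_comp A : forall rho rho',
  srename rho' (srename rho A) = srename (fun i => rho' (rho i)) A.
Proof.
  induction A as [| | | |A IHA B IHB|A IHA|A IHA]; intros rho rho'; simpl;
    rewrite ?IHA, ?IHB; try reflexivity.
  f_equal. f_equal. extensionality i. now destruct i.
Qed.

Lemma srename_id A : srename (fun i => i) A = A.
Proof.
  induction A; simpl; try congruence.
  f_equal. rewrite <- IHA at 2. f_equal. extensionality i. now destruct i.
Qed.

Lemma srename_subst A : forall rho sigma,
  srename rho (subst sigma A) = subst sigma (srename rho A).
Proof.
  induction A as [| | | |A IHA B IHB|A IHA|A IHA]; intros; simpl;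
    rewrite ?IHA, ?IHB; reflexivity.
Qed.

Lemma inst_subst_up t sigma A : inst t (subst (up sigma) A) = subst (scons t sigma) A.
Proof.
  unfold inst. rewrite subst_comp. f_equal. extensionality i. destruct i as [|i]; [easy|].
  simpl. now rewrite tsubst_scons_lift, tsubst_var.
Qed.

Lemma subst_inst sigma t A :
  subst sigma (inst t A) = inst (tsubst sigma t) (subst (up sigma) A).
Proof.
  rewrite inst_subst_up. unfold inst. rewrite subst_comp. f_equal.
  extensionality i. now destruct i.
Qed.

Lemma subst_up_shift sigma A : subst (up sigma) (shift A) = shift (subst sigma A).
Proof. unfold shift. now rewrite !subst_comp. Qed.

Lemma srename_inst rho t A : srename rho (inst t A) = inst t (srename rho A).
Proof. apply srename_subst. Qed.

Lemma instS_srename_sup X rho A : instS X (srename (sup rho) A) = srename (scons X rho) A.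
Proof.
  unfold instS. rewrite srename_comp. f_equal. extensionality i. now destruct i.
Qed.

Lemma srename_instS rho X A :
  srename rho (instS X A) = instS (rho X) (srename (sup rho) A).
Proof.
  rewrite instS_srename_sup. unfold instS. rewrite srename_comp. f_equal.
  extensionality i. now destruct i.
Qed.

Lemma srename_sup_shiftS rho A : srename (sup rho) (shiftS A) = shiftS (srename rho A).
Proof. unfold shiftS. now rewrite !srename_comp. Qed.

Lemma subst_instS sigma X A : subst sigma (instS X A) = instS X (subst sigma A).
Proof. symmetry. apply srename_subst. Qed.

(** All free number variables have index below n, phrased by the action of substitutions so that
    freshness needs no computation of free variables. *)
Definition bounded (n : nat) (A : form) : Prop :=
  forall sigma tau, (forall i, i < n -> sigma i = tau i) -> subst sigma A = subst tau A.

Definition sbounded (n : nat) (A : form) : Prop :=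
  forall rho rho', (forall i, i < n -> rho i = rho' i) -> srename rho A = srename rho' A.

Lemma tbounded_ex t : exists n, forall sigma tau,
  (forall i, i < n -> sigma i = tau i) -> tsubst sigma t = tsubst tau t.
Proof.
  induction t as [i| | |s [n Hn] t [m Hm]|s [n Hn] t [m Hm]|s [n Hn] t [m Hm]];
    [exists (S i); simpl; intros; auto| now exists 0 | now exists 0 | | |];
    exists (n + m); intros sigma tau H; simpl;
    (rewrite (Hn sigma tau), (Hm sigma tau); [easy| |]; intros; apply H; lia).
Qed.

Lemma bounded_ex A : exists n, bounded n A.
Proof.
  induction A as [s t|s t|t X| |A [n Hn] B [m Hm]|A [n Hn]|A [n Hn]].
  1,2: destruct (tbounded_ex s) as [n Hn], (tbounded_ex t) as [m Hm];
    exists (n + m); intros sigma tau H; simpl;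
    (rewrite (Hn sigma tau), (Hm sigma tau); [easy| |]; intros; apply H; lia).
  - destruct (tbounded_ex t) as [n Hn]. exists n. intros sigma tau H. simpl.
    now rewrite (Hn sigma tau).
  - now exists 0.
  - exists (n + m). intros sigma tau H. simpl.
    rewrite (Hn sigma tau), (Hm sigma tau); [easy| |]; intros; apply H; lia.
  - exists n. intros sigma tau H. simpl. f_equal. apply Hn. intros i Hi.
    destruct i as [|i]; [easy|]. simpl. rewrite H; [easy|lia].
  - exists n. intros sigma tau H. simpl. f_equal. now apply Hn.
Qed.

Lemma sbounded_ex A : exists n, sbounded n A.
Proof.
  induction A as [s t|s t|t X| |A [n Hn] B [m Hm]|A [n Hn]|A [n Hn]];
    try (now exists 0).
  - exists (S X). intros rho rho' H. simpl. rewrite H; [easy|lia].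
  - exists (n + m). intros rho rho' H. simpl.
    rewrite (Hn rho rho'), (Hm rho rho'); [easy| |]; intros; apply H; lia.
  - exists n. intros rho rho' H. simpl. f_equal. now apply Hn.
  - exists n. intros rho rho' H. simpl. f_equal. apply Hn. intros i Hi.
    destruct i as [|i]; [easy|]. simpl. rewrite H; [easy|lia].
Qed.

Lemma bounded_list_ex (G : list form) : exists n, forall A, In A G -> bounded n A.
Proof.
  induction G as [|A G [n Hn]]; [now exists 0|].
  destruct (bounded_ex A) as [m Hm]. exists (n + m).
  intros B [<-|HB] sigma tau H; [apply Hm|apply (Hn B HB)]; intros; apply H; lia.
Qed.

Lemma sbounded_list_ex (G : list form) : exists n, forall A, In A G -> sbounded n A.
Proof.
  induction G as [|A G [n Hn]]; [now exists 0|].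
  destruct (sbounded_ex A) as [m Hm]. exists (n + m).
  intros B [<-|HB] sigma tau H; [apply Hm|apply (Hn B HB)]; intros; apply H; lia.
Qed.

(** * Derivations *)

Section Derivations.
Context (T : form -> Prop).

Lemma derives_weak G A : derives T G A -> forall G', incl G G' -> derives T G' A.
Proof.
  intro H; induction H; intros G' HG.
  - now apply d_axiom.
  - apply d_hyp, HG; assumption.
  - apply d_impI, IHderives. intros C [<-|HC]; [now left|right; auto].
  - eapply d_impE; eauto.
  - apply d_raa, IHderives. intros C [<-|HC]; [now left|right; auto].
  - apply d_allI, IHderives, incl_map, HG.
  - apply d_allE; auto.
  - apply d_allSI, IHderives, incl_map, HG.
  - apply d_allSE; auto.
  - apply d_refl.
  - eapply d_leibniz; eauto.
Qed.

(** Agrees with sigma below n and sends n + i to [Var i]: the simultaneous substitution that results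
    from n generalizations followed by n instantiations. *)
Fixpoint keep (n : nat) (sigma : nat -> term) : nat -> term :=
  match n with 0 => Var | S n => scons (sigma 0) (keep n (fun i => sigma (S i))) end.

Fixpoint skeep (n : nat) (rho : nat -> nat) : nat -> nat :=
  match n with 0 => fun i => i | S n => scons (rho 0) (skeep n (fun i => rho (S i))) end.

Lemma keep_lt n : forall sigma i, i < n -> keep n sigma i = sigma i.
Proof.
  induction n as [|n IH]; intros sigma i Hi; [lia|].
  destruct i as [|i]; simpl; [easy|]. rewrite IH; [easy|lia].
Qed.

Lemma skeep_lt n : forall rho i, i < n -> skeep n rho i = rho i.
Proof.
  induction n as [|n IH]; intros rho i Hi; [lia|].
  destruct i as [|i]; simpl; [easy|]. rewrite IH; [easy|lia].
Qed.

(* The hypothesis ranges over all G because [d_allI] shifts the context. *)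
Lemma derives_keep n : forall sigma A,
  (forall G, derives T G A) -> forall G, derives T G (subst (keep n sigma) A).
Proof.
  induction n as [|n IH]; intros sigma A HA G; simpl.
  - now rewrite subst_var.
  - rewrite <- inst_subst_up. apply d_allE.
    apply (IH _ (All A)). intro G'. apply d_allI, HA.
Qed.

Lemma derives_skeep n : forall rho A,
  (forall G, derives T G A) -> forall G, derives T G (srename (skeep n rho) A).
Proof.
  induction n as [|n IH]; intros rho A HA G; simpl.
  - now rewrite srename_id.
  - rewrite <- instS_srename_sup. apply d_allSE.
    apply (IH _ (AllS A)). intro G'. apply d_allSI, HA.
Qed.

(** Axioms have free variables, and T need not be closed under substitution. Since an axiom has
    finitely many variables, [keep] with n large enough acts on it as sigma does. *)
Lemma derives_axiom_subst A sigma G : T A -> derives T G (subst sigma A).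
Proof.
  intro HA. destruct (bounded_ex A) as [n Hn].
  rewrite (Hn sigma (keep n sigma)) by (intros; symmetry; now apply keep_lt).
  apply derives_keep. intro. now apply d_axiom.
Qed.

Lemma derives_axiom_srename A rho G : T A -> derives T G (srename rho A).
Proof.
  intro HA. destruct (sbounded_ex A) as [n Hn].
  rewrite (Hn rho (skeep n rho)) by (intros; symmetry; now apply skeep_lt).
  apply derives_skeep. intro. now apply d_axiom.
Qed.

Lemma derives_subst G A : derives T G A ->
  forall sigma, derives T (map (subst sigma) G) (subst sigma A).
Proof.
  intro H; induction H; intro sigma; simpl in *.
  - now apply derives_axiom_subst.
  - apply d_hyp, in_map; assumption.
  - apply d_impI, IHderives.
  - eapply d_impE; eauto.
  - apply d_raa, IHderives.
  - apply d_allI. specialize (IHderives (up sigma)).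
    rewrite map_map in IHderives |- *.
    erewrite map_ext; [exact IHderives|]. intro B. symmetry. apply subst_up_shift.
  - rewrite subst_inst. apply d_allE, IHderives.
  - apply d_allSI. specialize (IHderives sigma).
    rewrite map_map in IHderives |- *.
    erewrite map_ext; [exact IHderives|]. intro B. apply srename_subst.
  - rewrite subst_instS. apply d_allSE, IHderives.
  - apply d_refl.
  - rewrite subst_inst. eapply d_leibniz; [apply IHderives1|].
    rewrite <- subst_inst. apply IHderives2.
Qed.

Lemma derives_srename G A : derives T G A ->
  forall rho, derives T (map (srename rho) G) (srename rho A).
Proof.
  intro H; induction H; intro rho; simpl in *.
  - now apply derives_axiom_srename.
  - apply d_hyp, in_map; assumption.
  - apply d_impI, IHderives.
  - eapply d_impE; eauto.
  - apply d_raa, IHderives.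
  - apply d_allI. specialize (IHderives rho).
    rewrite map_map in IHderives |- *.
    erewrite map_ext; [exact IHderives|]. intro B. symmetry. apply srename_subst.
  - rewrite srename_inst. apply d_allE, IHderives.
  - apply d_allSI. specialize (IHderives (sup rho)).
    rewrite map_map in IHderives |- *.
    erewrite map_ext; [exact IHderives|]. intro B. symmetry. apply srename_sup_shiftS.
  - rewrite srename_instS. apply d_allSE, IHderives.
  - apply d_refl.
  - rewrite srename_inst. eapply d_leibniz; [apply IHderives1|].
    rewrite <- srename_inst. apply IHderives2.
Qed.

(** The rule with a named eigenvariable. Sending v to index 0 and every other index one up acts as
    [shift] on formulas whose indices are all below v, which turns a derivation about v into the
    premise of [d_allI]. *)
Lemma derives_fresh v G A :
  (forall B, In B (All A :: G) -> bounded v B) -> derives T G (inst (Var v) A) ->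
  derives T G (All A).
Proof.
  intros Hv H. apply d_allI.
  set (sigma := fun i => if i =? v then Var 0 else Var (S i)).
  assert (Hs : forall i, i < v -> sigma i = Var (S i)).
  { intros i Hi. unfold sigma. destruct (Nat.eqb_spec i v); [lia|easy]. }
  assert (Hsv : sigma v = Var 0) by (unfold sigma; now rewrite Nat.eqb_refl).
  apply derives_subst with (sigma := sigma) in H.
  rewrite (map_ext_in _ shift) in H
    by (intros B HB; apply (Hv B (or_intror HB)), Hs).
  rewrite subst_inst, inst_subst_up in H. simpl in H. rewrite Hsv in H.
  assert (HA : All (subst (up sigma) A) = All (subst (up (fun i => Var (S i))) A))
    by (apply (Hv (All A)); [now left|exact Hs]).
  injection HA as HA.
  rewrite <- inst_subst_up, HA, inst_subst_up in H.
  replace (scons (Var 0) (fun i => Var (S i))) with Var in H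
    by (extensionality i; now destruct i).
  now rewrite subst_var in H.
Qed.

Lemma derives_freshS v G A :
  (forall B, In B (AllS A :: G) -> sbounded v B) -> derives T G (instS v A) ->
  derives T G (AllS A).
Proof.
  intros Hv H. apply d_allSI.
  set (rho := fun i => if i =? v then 0 else S i).
  assert (Hs : forall i, i < v -> rho i = S i).
  { intros i Hi. unfold rho. destruct (Nat.eqb_spec i v); [lia|easy]. }
  assert (Hsv : rho v = 0) by (unfold rho; now rewrite Nat.eqb_refl).
  apply derives_srename with (rho := rho) in H.
  rewrite (map_ext_in _ shiftS) in H
    by (intros B HB; apply (Hv B (or_intror HB)), Hs).
  rewrite srename_instS, instS_srename_sup in H. rewrite Hsv in H.
  assert (HA : AllS (srename (sup rho) A) = AllS (srename (sup S) A))
    by (apply (Hv (AllS A)); [now left|exact Hs]).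
  injection HA as HA.
  rewrite <- instS_srename_sup, HA, instS_srename_sup in H.
  replace (scons 0 S) with (fun i : nat => i) in H
    by (extensionality i; now destruct i).
  now rewrite srename_id in H.
Qed.

Lemma derives_efq G A : derives T G Bot -> derives T G A.
Proof. intro H. apply d_raa. eapply derives_weak; [exact H|]. now right. Qed.

End Derivations.

(** * Completeness for two-sorted structures *)

(** The set sort is an arbitrary type with a membership relation, not a power set; this is the
    semantics for which the calculus is complete. *)
Record structure := {
  dom : Type;
  sets : Type;
  zero : dom;
  one : dom;
  plus : dom -> dom -> dom;
  times : dom -> dom -> dom;
  power : dom -> dom -> dom;
  lt : dom -> dom -> Prop;
  mem : dom -> sets -> Prop }.

Arguments zero {_}.
Arguments one {_}.
Arguments plus {_} _ _.
Arguments times {_} _ _.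
Arguments power {_} _ _.
Arguments lt {_} _ _.
Arguments mem {_} _ _.

Fixpoint eval {M : structure} (e : nat -> dom M) (t : term) : dom M :=
  match t with
  | Var i => e i
  | Zero => zero
  | One => one
  | Plus s t => plus (eval e s) (eval e t)
  | Times s t => times (eval e s) (eval e t)
  | Exp s t => power (eval e s) (eval e t)
  end.

Fixpoint sat {M : structure} (e : nat -> dom M) (E : nat -> sets M) (A : form) : Prop :=
  match A with
  | Equal s t => eval e s = eval e t
  | Less s t => lt (eval e s) (eval e t)
  | Mem t X => mem (eval e t) (E X)
  | Bot => False
  | Imp A B => sat e E A -> sat e E B
  | All A => forall x, sat (scons x e) E A
  | AllS A => forall X, sat e (scons X E) A
  end.

(** * Numbering of terms and formulas *)

Fixpoint term_code (t : term) : nat :=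
  match t with
  | Var i => to_nat (0, i)
  | Zero => to_nat (1, 0)
  | One => to_nat (1, 1)
  | Plus s t => to_nat (2, to_nat (term_code s, term_code t))
  | Times s t => to_nat (3, to_nat (term_code s, term_code t))
  | Exp s t => to_nat (4, to_nat (term_code s, term_code t))
  end.

Fixpoint form_code (A : form) : nat :=
  match A with
  | Equal s t => to_nat (0, to_nat (term_code s, term_code t))
  | Less s t => to_nat (1, to_nat (term_code s, term_code t))
  | Mem t X => to_nat (2, to_nat (term_code t, X))
  | Bot => to_nat (3, 0)
  | Imp A B => to_nat (4, to_nat (form_code A, form_code B))
  | All A => to_nat (5, form_code A)
  | AllS A => to_nat (6, form_code A)
  end.

Ltac code_inj :=
  repeat match goal with
  | H : to_nat _ = to_nat _ |- _ =>
    apply to_nat_inj, pair_equal_spec in H; destruct H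
  end; try discriminate.

Lemma term_code_inj s : forall t, term_code s = term_code t -> s = t.
Proof.
  induction s; intros []; cbn -[to_nat]; intro H; code_inj; try reflexivity;
    f_equal; auto.
Qed.

Lemma form_code_inj A : forall B, form_code A = form_code B -> A = B.
Proof.
  induction A; intros []; cbn -[to_nat]; intro H; code_inj; try reflexivity;
    f_equal; auto using term_code_inj.
Qed.

Section Completeness.
Context (T : form -> Prop).

Definition consistent (G : list form) : Prop := ~ derives T G Bot.

(** A rejected universal statement is given a counterexample as soon as it is rejected. Contexts are
    finite lists, so a fresh variable of the language can serve as the witness and no new constants
    are required; a contradiction from the witness would derive the universal statement. *)
Lemma henkin_step (A : form) (G : list form) : consistent G ->
  exists G', consistent G' /\ incl G G' /\
    (consistent (A :: G) ->
       In A G' /\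
       (forall B, A = Neg (All B) -> exists t, In (Neg (inst t B)) G') /\
       (forall B, A = Neg (AllS B) -> exists X, In (Neg (instS X B)) G')).
Proof.
  intro HG. destruct (classic (consistent (A :: G))) as [HA|HA].
  2:{ exists G. repeat split; [easy|apply incl_refl| | |]; intros; contradiction. }
  destruct (classic (exists B, A = Neg (All B))) as [[B ->]|HB].
  { destruct (bounded_list_ex (All B :: Neg (All B) :: G)) as [v Hv].
    exists (Neg (inst (Var v) B) :: Neg (All B) :: G). split; [|split].
    - intro H. apply HA. eapply d_impE; [apply d_hyp; now left|].
      apply derives_fresh with v; [exact Hv|]. now apply d_raa.
    - intros C HC. right. now right.
    - intros _. split; [right; now left|]. split.
      + intros C [= <-]. exists (Var v). now left.
      + intros C [=]. }
  destruct (classic (exists B, A = Neg (AllS B))) as [[B ->]|HB'].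
  { destruct (sbounded_list_ex (AllS B :: Neg (AllS B) :: G)) as [v Hv].
    exists (Neg (instS v B) :: Neg (AllS B) :: G). split; [|split].
    - intro H. apply HA. eapply d_impE; [apply d_hyp; now left|].
      apply derives_freshS with v; [exact Hv|]. now apply d_raa.
    - intros C HC. right. now right.
    - intros _. split; [right; now left|]. split.
      + intros C [=].
      + intros C [= <-]. exists v. now left. }
  exists (A :: G). split; [easy|]. split; [now right|].
  intros _. split; [now left|]. split; intros B ->; exfalso; eauto.
Qed.

(** * The maximal consistent theory with witnesses *)

Context (G0 : list form) (G0_consistent : consistent G0).

(** A left inverse of [form_code] by choice. Its values at numbers that code nothing are arbitrary,
    which is harmless because [henkin_step] accepts any formula. *)
Definition enum (n : nat) : form :=
  epsilon (inhabits Bot) (fun A => form_code A = n).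

Lemma enum_code A : enum (form_code A) = A.
Proof.
  apply form_code_inj. unfold enum.
  apply (epsilon_spec (inhabits Bot) (fun B => form_code B = form_code A)). now exists A.
Qed.

Definition next (A : form) (G : list form) : list form :=
  epsilon (inhabits G) (fun G' => consistent G' /\ incl G G' /\
    (consistent (A :: G) ->
       In A G' /\
       (forall B, A = Neg (All B) -> exists t, In (Neg (inst t B)) G') /\
       (forall B, A = Neg (AllS B) -> exists X, In (Neg (instS X B)) G'))).

Fixpoint stage (n : nat) : list form :=
  match n with 0 => G0 | S n => next (enum n) (stage n) end.

Lemma stage_consistent n : consistent (stage n).
Proof.
  induction n as [|n IH]; [exact G0_consistent|]. simpl. unfold next.
  apply (epsilon_spec (inhabits (stage n)) _ (henkin_step (enum n) _ IH)).
Qed.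

Lemma stage_next n :
  incl (stage n) (stage (S n)) /\
  (consistent (enum n :: stage n) ->
     In (enum n) (stage (S n)) /\
     (forall B, enum n = Neg (All B) -> exists t, In (Neg (inst t B)) (stage (S n))) /\
     (forall B, enum n = Neg (AllS B) -> exists X, In (Neg (instS X B)) (stage (S n)))).
Proof.
  exact (proj2 (epsilon_spec (inhabits (stage n)) _
                  (henkin_step (enum n) _ (stage_consistent n)))).
Qed.

Lemma stage_mono n m : n <= m -> incl (stage n) (stage m).
Proof.
  induction 1 as [|m _ IH]; [apply incl_refl|].
  eapply incl_tran; [exact IH|]. apply stage_next.
Qed.

Definition limit (A : form) : Prop := exists n, derives T (stage n) A.

Lemma limit_list (G : list form) :
  (forall A, In A G -> limit A) -> exists n, forall A, In A G -> derives T (stage n) A.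
Proof.
  induction G as [|A G IH]; intro HG; [now exists 0|].
  destruct IH as [n Hn]; [intros; apply HG; now right|].
  destruct (HG A (or_introl eq_refl)) as [m Hm].
  exists (n + m). intros B [<-|HB]; eapply derives_weak.
  1: exact Hm. 2: apply Hn, HB. all: apply stage_mono; lia.
Qed.

Lemma derives_cut G : forall G' A, derives T G A ->
  (forall B, In B G -> derives T G' B) -> derives T G' A.
Proof.
  induction G as [|B G IH]; intros G' A HA HG.
  - eapply derives_weak; [exact HA|]. intros B [].
  - eapply d_impE; [|apply HG; now left]. apply IH.
    + now apply d_impI.
    + intros; apply HG; now right.
Qed.

Lemma limit_closed G A : derives T G A -> (forall B, In B G -> limit B) -> limit A.
Proof.
  intros HA HG. destruct (limit_list G HG) as [n Hn]. exists n.
  eapply derives_cut; eauto.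
Qed.

Lemma limit_bot : ~ limit Bot.
Proof. intros [n Hn]. exact (stage_consistent n Hn). Qed.

Lemma limit_stage n A : In A (stage n) -> limit A.
Proof. intro H. exists n. now apply d_hyp. Qed.

(** Maximality is decided at the stage numbered by the code of [Neg A]: either [Neg A] is consistent
    with that stage and is added, or the stage derives A. *)
Lemma limit_neg A : ~ limit A <-> limit (Neg A).
Proof.
  split; intro HA.
  - apply NNPP. intro HN.
    destruct (stage_next (form_code (Neg A))) as [_ H]. rewrite enum_code in H.
    apply HN. apply limit_stage with (S (form_code (Neg A))). apply H.
    intro H'. apply HA. exists (form_code (Neg A)). now apply d_raa.
  - intro HA'. apply limit_bot. apply limit_closed with [Neg A; A].
    + eapply d_impE; apply d_hyp; [now left|right; now left].
    + intros B [<-|[<-|[]]]; assumption.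
Qed.

Lemma limit_enum A : limit A -> consistent (A :: stage (form_code A)).
Proof.
  intros [n Hn] H. apply limit_bot. apply limit_closed with (A :: stage (form_code A)).
  - exact H.
  - intros B [<-|HB]; [now exists n|now apply limit_stage in HB].
Qed.

Lemma limit_imp A B : limit (Imp A B) <-> (limit A -> limit B).
Proof.
  split.
  - intros HAB HA. apply limit_closed with [Imp A B; A].
    + eapply d_impE; apply d_hyp; [now left|right; now left].
    + intros C [<-|[<-|[]]]; assumption.
  - intro H. destruct (classic (limit A)) as [HA|HA].
    + apply limit_closed with [B].
      * apply d_impI, d_hyp. right; now left.
      * intros C [<-|[]]; auto.
    + apply limit_neg in HA. apply limit_closed with [Neg A].
      * apply d_impI, derives_efq. eapply d_impE; apply d_hyp; [right|]; now left.
      * intros C [<-|[]]; auto.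
Qed.

(** If [All A] is missing, its negation belongs to the theory, hence was consistent at its own stage
    and was added there together with a counterexample. *)
Lemma limit_all A : limit (All A) <-> forall t, limit (inst t A).
Proof.
  split.
  - intros HA t. apply limit_closed with [All A].
    + apply d_allE, d_hyp. now left.
    + intros C [<-|[]]; auto.
  - intro H. apply NNPP. intro HA. apply limit_neg in HA.
    destruct (stage_next (form_code (Neg (All A)))) as [_ HS].
    rewrite enum_code in HS. destruct (HS (limit_enum _ HA)) as (_ & Ht & _).
    destruct (Ht A eq_refl) as [t Hin]. apply limit_stage in Hin.
    apply limit_neg in Hin. apply Hin, H.
Qed.

Lemma limit_allS A : limit (AllS A) <-> forall X, limit (instS X A).
Proof.
  split.
  - intros HA X. apply limit_closed with [AllS A].
    + apply d_allSE, d_hyp. now left.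
    + intros C [<-|[]]; auto.
  - intro H. apply NNPP. intro HA. apply limit_neg in HA.
    destruct (stage_next (form_code (Neg (AllS A)))) as [_ HS].
    rewrite enum_code in HS. destruct (HS (limit_enum _ HA)) as (_ & _ & Ht).
    destruct (Ht A eq_refl) as [X Hin]. apply limit_stage in Hin.
    apply limit_neg in Hin. apply Hin, H.
Qed.

(** * The term model *)

Definition teq (s t : term) : Prop := limit (Equal s t).

Lemma teq_refl t : teq t t.
Proof. exists 0. apply d_refl. Qed.

Lemma teq_leibniz s t A : teq s t -> limit (inst s A) -> limit (inst t A).
Proof.
  intros Hst HA. apply limit_closed with [Equal s t; inst s A].
  - eapply d_leibniz; apply d_hyp; [now left|right; now left].
  - intros C [<-|[<-|[]]]; assumption.
Qed.

Lemma inst_lift t u : tsubst (scons u Var) (lift 1 t) = t.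
Proof. now rewrite tsubst_scons_lift, tsubst_var. Qed.

Lemma teq_sym s t : teq s t -> teq t s.
Proof.
  intro H. generalize (teq_leibniz s t (Equal (Var 0) (lift 1 s)) H).
  unfold inst; simpl. rewrite !inst_lift. intro H'. apply H', teq_refl.
Qed.

Lemma teq_trans s t u : teq s t -> teq t u -> teq s u.
Proof.
  intros H1 H2. generalize (teq_leibniz t u (Equal (lift 1 s) (Var 0)) H2).
  unfold inst; simpl. rewrite !inst_lift. intro H. now apply H.
Qed.

Lemma teq_op (f : term -> term -> term) :
  (forall sigma s t, tsubst sigma (f s t) = f (tsubst sigma s) (tsubst sigma t)) ->
  forall s s' t t', teq s s' -> teq t t' -> teq (f s t) (f s' t').
Proof.
  intros Hf s s' t t' Hs Ht. apply teq_trans with (f s' t).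
  - generalize (teq_leibniz s s' (Equal (f (lift 1 s) (lift 1 t)) (f (Var 0) (lift 1 t))) Hs).
    unfold inst; simpl. rewrite !Hf, !inst_lift. intro H. apply H, teq_refl.
  - generalize (teq_leibniz t t' (Equal (f (lift 1 s') (lift 1 t)) (f (lift 1 s') (Var 0))) Ht).
    unfold inst; simpl. rewrite !Hf, !inst_lift. intro H. apply H, teq_refl.
Qed.

Lemma limit_less s s' t t' : teq s s' -> teq t t' -> limit (Less s t) -> limit (Less s' t').
Proof.
  intros Hs Ht H.
  generalize (teq_leibniz s s' (Less (Var 0) (lift 1 t)) Hs).
  generalize (teq_leibniz t t' (Less (lift 1 s') (Var 0)) Ht).
  unfold inst; simpl. rewrite !inst_lift. auto.
Qed.

Lemma limit_mem t t' X : teq t t' -> limit (Mem t X) -> limit (Mem t' X).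
Proof. exact (teq_leibniz t t' (Mem (Var 0) X)). Qed.

(** [sat] reads [Equal] as identity, so provably equal terms must become one element. Taking the
    predicate [teq t] itself as the class makes this a genuine quotient by extensionality. *)
Definition tclass : Type := {c : term -> Prop | exists t, c = teq t}.

Definition class (t : term) : tclass := exist _ (teq t) (ex_intro _ t eq_refl).

Definition repr (c : tclass) : term :=
  proj1_sig (constructive_indefinite_description _ (proj2_sig c)).

Lemma class_eq s t : class s = class t <-> teq s t.
Proof.
  split.
  - intro H. apply (f_equal (@proj1_sig _ _)) in H. simpl in H. rewrite H. apply teq_refl.
  - intro H. apply subset_eq_compat. extensionality u. apply propositional_extensionality.
    split; intro H'; [apply teq_sym in H|]; eapply teq_trans; eauto.
Qed.

Lemma class_repr c : class (repr c) = c.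
Proof.
  destruct c as [c Hc]. apply subset_eq_compat. unfold repr; simpl.
  now destruct (constructive_indefinite_description _ Hc).
Qed.

Lemma teq_repr t : teq (repr (class t)) t.
Proof. apply class_eq, class_repr. Qed.

(** Set terms are variables and sets carry no equality, so set indices serve as the set sort without
    a quotient. *)
Definition term_model : structure := {|
  dom := tclass;
  sets := nat;
  zero := class Zero;
  one := class One;
  plus c d := class (Plus (repr c) (repr d));
  times c d := class (Times (repr c) (repr d));
  power c d := class (Exp (repr c) (repr d));
  lt c d := limit (Less (repr c) (repr d));
  mem c X := limit (Mem (repr c) X) |}.

Lemma term_model_eval (sigma : nat -> term) t :
  eval (M := term_model) (fun i => class (sigma i)) t = class (tsubst sigma t).
Proof.
  induction t; simpl; try reflexivity; rewrite IHt1, IHt2; apply class_eq.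
  - apply teq_op; auto using teq_repr.
  - apply teq_op; auto using teq_repr.
  - apply teq_op; auto using teq_repr.
Qed.

(** Every element is the class of a term, so a quantifier over the domain is one over instances.
    Generality in sigma and rho lets the quantifier cases apply the induction hypothesis to an
    extended environment. *)
Lemma truth A : forall (sigma : nat -> term) (rho : nat -> nat),
  sat (M := term_model) (fun i => class (sigma i)) rho A <->
  limit (srename rho (subst sigma A)).
Proof.
  induction A as [s t|s t|t X| |A IHA B IHB|A IHA|A IHA]; intros sigma rho; simpl.
  - rewrite !term_model_eval. apply class_eq.
  - rewrite !term_model_eval. split; apply limit_less; auto using teq_repr, teq_sym.
  - rewrite !term_model_eval. split; apply limit_mem; auto using teq_repr, teq_sym.
  - split; [easy|]. apply limit_bot.
  - rewrite IHA, IHB. symmetry. apply limit_imp.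
  - rewrite limit_all. split.
    + intros H t. rewrite <- srename_inst, inst_subst_up. apply IHA.
      specialize (H (class t)).
      replace (fun i => class (scons t sigma i)) with (scons (class t) (fun i => class (sigma i)));
        [exact H|]. extensionality i. now destruct i.
    + intros H c. rewrite <- (class_repr c). specialize (H (repr c)).
      rewrite <- srename_inst, inst_subst_up in H. apply IHA in H.
      replace (scons (class (repr c)) (fun i => class (sigma i)))
        with (fun i => class (scons (repr c) sigma i));
        [exact H|]. extensionality i. now destruct i.
  - fold (sup rho). rewrite limit_allS. split.
    + intros H X. rewrite instS_srename_sup. apply IHA, H.
    + intros H X. apply IHA. rewrite <- instS_srename_sup. apply H.
Qed.

Lemma term_model_axiom A : T A -> forall e E, sat (M := term_model) e E A.
Proof.
  intros HA e E.
  replace e with (fun i => class (repr (e i)))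
    by (extensionality i; apply class_repr).
  apply truth. rewrite srename_subst.
  exists 0. apply derives_weak with (map (subst (fun i => repr (e i))) []); [|intros B []].
  apply derives_subst. now apply derives_axiom_srename.
Qed.

End Completeness.

Theorem completeness (T : form -> Prop) (A : form) :
  (forall M : structure, (forall B, T B -> forall e E, sat (M := M) e E B) ->
     forall e E, sat (M := M) e E A) ->
  proves T A.
Proof.
  intro H. apply NNPP. intro HA.
  assert (HC : consistent T [Neg A]) by (intro H'; now apply HA, d_raa).
  specialize (H _ (term_model_axiom T _ HC) (fun i => class T _ (Var i)) (fun i => i)).
  apply truth in H; [|exact HC].
  rewrite subst_var, srename_id in H.
  revert H. apply limit_neg; [exact HC|]. exists 0. apply d_hyp. now left.
Qed.

(** * Satisfaction and definability *)

Section Satisfaction.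
Context {M : structure}.
Implicit Types (e : nat -> dom M) (E : nat -> sets M).

Lemma eval_tsubst e sigma t : eval e (tsubst sigma t) = eval (fun i => eval e (sigma i)) t.
Proof. induction t; simpl; congruence. Qed.

Lemma eval_lift e k t : eval e (lift k t) = eval (fun i => e (k + i)) t.
Proof. apply eval_tsubst. Qed.

Lemma sat_ext e e' E E' A :
  (forall i, e i = e' i) -> (forall i, E i = E' i) -> sat e E A <-> sat e' E' A.
Proof.
  intros He HE. apply functional_extensionality in He, HE. now subst.
Qed.

Lemma sat_subst A : forall e E sigma,
  sat e E (subst sigma A) <-> sat (fun i => eval e (sigma i)) E A.
Proof.
  induction A as [s t|s t|t X| |A IHA B IHB|A IHA|A IHA]; intros e E sigma; simpl;
    rewrite ?eval_tsubst; try reflexivity.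
  - now rewrite IHA, IHB.
  - enough (H : forall x, sat (scons x e) E (subst (up sigma) A) <->
                  sat (scons x (fun i => eval e (sigma i))) E A) by firstorder.
    intro x. rewrite IHA. apply sat_ext; [|easy]. intros [|i]; [easy|].
    simpl. now rewrite eval_lift.
  - split; intros H X; apply IHA, H.
Qed.

Lemma sat_srename A : forall e E rho,
  sat e E (srename rho A) <-> sat e (fun i => E (rho i)) A.
Proof.
  induction A as [s t|s t|t X| |A IHA B IHB|A IHA|A IHA]; intros e E rho; simpl;
    try reflexivity.
  - now rewrite IHA, IHB.
  - split; intros H x; apply IHA, H.
  - enough (H : forall X, sat e (scons X E) (srename (scons 0 (fun i => S (rho i))) A) <->
                  sat e (scons X (fun i => E (rho i))) A) by firstorder.
    intro X. rewrite IHA. apply sat_ext; [easy|]. now intros [|i].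
Qed.

Lemma sat_imp e E A B : sat e E (Imp A B) <-> (sat e E A -> sat e E B).
Proof. reflexivity. Qed.

Lemma sat_neg e E A : sat e E (Neg A) <-> ~ sat e E A.
Proof. reflexivity. Qed.

Lemma sat_and e E A B : sat e E (And A B) <-> sat e E A /\ sat e E B.
Proof. simpl. tauto. Qed.

Lemma sat_or e E A B : sat e E (Or A B) <-> sat e E A \/ sat e E B.
Proof. simpl. tauto. Qed.

Lemma sat_iff e E A B : sat e E (Iff A B) <-> (sat e E A <-> sat e E B).
Proof. unfold Iff. rewrite sat_and. reflexivity. Qed.

Lemma sat_ex e E A : sat e E (Ex A) <-> exists x, sat (scons x e) E A.
Proof.
  simpl. split; [|firstorder]. intro H. apply NNPP. firstorder.
Qed.

Lemma sat_exS e E A : sat e E (ExS A) <-> exists X, sat e (scons X E) A.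
Proof.
  simpl. split; [|firstorder]. intro H. apply NNPP. firstorder.
Qed.

Lemma sat_lesseq e E s t :
  sat e E (LessEq s t) <-> lt (eval e s) (eval e t) \/ eval e s = eval e t.
Proof. apply sat_or. Qed.

End Satisfaction.

Lemma Sigma00_subst A : Sigma00 A -> forall sigma, Sigma00 (subst sigma A).
Proof.
  induction 1; intro sigma; simpl; try now constructor.
  rewrite tsubst_up_lift. now constructor.
Qed.

Lemma Sigma00_srename A : Sigma00 A -> forall rho, Sigma00 (srename rho A).
Proof. induction 1; intro rho; simpl; now constructor. Qed.

(** * Environments with finitely many parameters in front *)

Definition prepend {X : Type} (l : list X) (f : nat -> X) : nat -> X := fold_right scons f l.

Lemma prepend_app_r {X : Type} (l l' : list X) f i :
  prepend (l' ++ l) f (length l' + i) = prepend l f i.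
Proof. induction l'; simpl; auto. Qed.

(** The renaming g comes before f: one renamed formula must work for all environments. *)
Lemma prepend_app_l {X : Type} (l l' : list X) :
  exists g, forall f i, prepend (l ++ l') f (g i) = prepend l f i.
Proof.
  induction l as [|x l [g Hg]].
  - exists (fun i => length l' + i). intros f i.
    rewrite <- (app_nil_r l') at 1. apply (prepend_app_r [] l').
  - exists (fun i => match i with 0 => 0 | S i => S (g i) end).
    intros f [|i]; simpl; [easy|]. apply Hg.
Qed.

Lemma prepend_scons {X : Type} (l : list X) :
  exists g, forall x f i, scons x (prepend l f) (g i) = prepend l (scons x f) i.
Proof.
  induction l as [|y l [g Hg]].
  - now exists (fun i => i).
  - exists (fun i => match i with 0 => 1 | S i => match g i with 0 => 0 | S j => S (S j) end end).
    intros x f [|i]; simpl; [easy|]. rewrite <- Hg. now destruct (g i).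
Qed.

Lemma prepend_rename {X : Type} (l : list X) g :
  exists g', forall f i, prepend l f (g' i) = prepend l (fun i => f (g i)) i.
Proof.
  induction l as [|x l [g' Hg]]; [now exists g|].
  exists (fun i => match i with 0 => 0 | S i => S (g' i) end).
  intros f [|i]; simpl; [easy|]. apply Hg.
Qed.

Section Definability.
Context {M : structure} (E0 : nat -> sets M).
Notation env := (nat -> dom M).

Definition tail (e : env) : env := fun i => e (S i).

(* Truth sets of Sigma00 formulas with parameters: l lists the number parameters and L the
   set parameters; E0 only fills the unused set variables. *)
Definition Delta0 (P : env -> Prop) : Prop := exists A l L, Sigma00 A /\
  forall e, sat (prepend l e) (prepend L E0) A <-> P e.

Definition definable (t : env -> dom M) : Prop := exists u l, forall e,
  eval (prepend l e) u = t e.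

Lemma Delta0_ext P Q : (forall e, P e <-> Q e) -> Delta0 P -> Delta0 Q.
Proof.
  intros H (A & l & L & HA & HP). exists A, l, L. split; [easy|].
  intro e. now rewrite HP.
Qed.

Lemma definable_app_r t u l l' : (forall e, eval (prepend l e) u = t e) ->
  exists u', forall e : env, eval (prepend (l' ++ l) e) u' = t e.
Proof.
  intro H. exists (tsubst (fun i => Var (length l' + i)) u). intro e.
  rewrite eval_tsubst, <- H. f_equal. extensionality i. apply prepend_app_r.
Qed.

Lemma definable_app_l t u l l' : (forall e, eval (prepend l e) u = t e) ->
  exists u', forall e : env, eval (prepend (l ++ l') e) u' = t e.
Proof.
  intro H. destruct (prepend_app_l l l') as [g Hg].
  exists (tsubst (fun i => Var (g i)) u). intro e.
  rewrite eval_tsubst, <- H. f_equal. extensionality i. apply Hg.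
Qed.

Lemma Delta0_app_r P A l L l' L' :
  Sigma00 A -> (forall e, sat (prepend l e) (prepend L E0) A <-> P e) ->
  exists A', Sigma00 A' /\
    forall e : env, sat (prepend (l' ++ l) e) (prepend (L' ++ L) E0) A' <-> P e.
Proof.
  intros HA H.
  exists (srename (fun i => length L' + i) (subst (fun i => Var (length l' + i)) A)).
  split; [now apply Sigma00_srename, Sigma00_subst|].
  intro e. rewrite sat_srename, sat_subst, <- H.
  apply sat_ext; intro i; apply prepend_app_r.
Qed.

Lemma Delta0_app_l P A l L l' L' :
  Sigma00 A -> (forall e, sat (prepend l e) (prepend L E0) A <-> P e) ->
  exists A', Sigma00 A' /\
    forall e : env, sat (prepend (l ++ l') e) (prepend (L ++ L') E0) A' <-> P e.
Proof.
  intros HA H.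
  destruct (prepend_app_l l l') as [g Hg], (prepend_app_l L L') as [g' Hg'].
  exists (srename g' (subst (fun i => Var (g i)) A)).
  split; [now apply Sigma00_srename, Sigma00_subst|].
  intro e. rewrite sat_srename, sat_subst, <- H.
  apply sat_ext; intro i; [apply Hg|apply Hg'].
Qed.

Lemma definable_pair t t' : definable t -> definable t' -> exists u u' l,
  forall e, eval (prepend l e) u = t e /\ eval (prepend l e) u' = t' e.
Proof.
  intros (u & l & Hu) (u' & l' & Hu').
  destruct (definable_app_l _ _ _ l' Hu) as [v Hv].
  destruct (definable_app_r _ _ _ l Hu') as [v' Hv'].
  now exists v, v', (l ++ l').
Qed.

Lemma Delta0_imp P Q : Delta0 P -> Delta0 Q -> Delta0 (fun e => P e -> Q e).
Proof.
  intros (A & l & L & HA & HP) (B & l' & L' & HB & HQ).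
  destruct (Delta0_app_l _ _ _ _ l' L' HA HP) as (A' & HA' & HP').
  destruct (Delta0_app_r _ _ _ _ l L HB HQ) as (B' & HB' & HQ').
  exists (Imp A' B'), (l ++ l'), (L ++ L'). split; [now constructor|].
  intro e. simpl. now rewrite HP', HQ'.
Qed.

Lemma Delta0_eq s t : definable s -> definable t -> Delta0 (fun e => s e = t e).
Proof.
  intros Hs Ht. destruct (definable_pair s t Hs Ht) as (u & v & l & H).
  exists (Equal u v), l, []. split; [constructor|]. intro e. simpl.
  destruct (H e) as [-> ->]. reflexivity.
Qed.

Lemma Delta0_lt s t : definable s -> definable t -> Delta0 (fun e => lt (s e) (t e)).
Proof.
  intros Hs Ht. destruct (definable_pair s t Hs Ht) as (u & v & l & H).
  exists (Less u v), l, []. split; [constructor|]. intro e. simpl.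
  destruct (H e) as [-> ->]. reflexivity.
Qed.

Lemma Delta0_mem t X : definable t -> Delta0 (fun e => mem (t e) X).
Proof.
  intros (u & l & H). exists (Mem u 0), l, [X]. split; [constructor|].
  intro e. simpl. now rewrite H.
Qed.

Lemma Delta0_false : Delta0 (fun _ => False).
Proof. exists Bot, [], []. split; [constructor|]. reflexivity. Qed.

Lemma Delta0_not P : Delta0 P -> Delta0 (fun e => ~ P e).
Proof. intro HP. apply Delta0_imp; [exact HP|apply Delta0_false]. Qed.

Lemma Delta0_and P Q : Delta0 P -> Delta0 Q -> Delta0 (fun e => P e /\ Q e).
Proof.
  intros HP HQ. apply Delta0_ext with (fun e => ~ (P e -> ~ Q e)); [intro; tauto|].
  apply Delta0_not, Delta0_imp, Delta0_not; assumption.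
Qed.

Lemma Delta0_or P Q : Delta0 P -> Delta0 Q -> Delta0 (fun e => P e \/ Q e).
Proof.
  intros HP HQ. apply Delta0_ext with (fun e => ~ P e -> Q e); [intro; tauto|].
  apply Delta0_imp; [apply Delta0_not|]; assumption.
Qed.

(** Q separates the outer environment from the bound element, so goals can be stated with ordinary
    quantifiers; the premise puts the element back as variable 0. *)
Lemma Delta0_ball t (Q : env -> dom M -> Prop) :
  definable t -> Delta0 (fun e => Q (tail e) (e 0)) ->
  Delta0 (fun e => forall x, lt x (t e) -> Q e x).
Proof.
  intros (u & l & Hu) (A & l' & L & HA & HQ).
  destruct (definable_app_l _ _ _ l' Hu) as [v Hv].
  destruct (Delta0_app_r _ _ _ _ l [] HA HQ) as (B & HB & HQ').
  (* Under the quantifier the new variable stands before the parameters, whereas B expects it after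
     them. *)
  destruct (prepend_scons (l ++ l')) as [g Hg].
  exists (All (Imp (Less (Var 0) (lift 1 v)) (subst (fun i => Var (g i)) B))), (l ++ l'), L.
  split; [now constructor; apply Sigma00_subst|].
  intro e. simpl.
  enough (H : forall x,
    sat (scons x (prepend (l ++ l') e)) (prepend L E0) (subst (fun i => Var (g i)) B) <-> Q e x).
  { split; intros H' x; specialize (H' x); rewrite eval_lift in *; simpl in *; cbn in *;
      rewrite Hv in *; intro Hx; apply H, H', Hx. }
  intro x. rewrite sat_subst. rewrite <- (HQ' (scons x e)).
  apply sat_ext; [apply Hg|easy].
Qed.

Lemma Delta0_bex t (Q : env -> dom M -> Prop) :
  definable t -> Delta0 (fun e => Q (tail e) (e 0)) ->
  Delta0 (fun e => exists x, lt x (t e) /\ Q e x).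
Proof.
  intros Ht HQ.
  apply Delta0_ext with (fun e => ~ forall x, lt x (t e) -> ~ Q e x).
  - intro e. split; [|firstorder]. intro H. apply NNPP. firstorder.
  - apply Delta0_not, (Delta0_ball t (fun e x => ~ Q e x)); [exact Ht|].
    now apply Delta0_not.
Qed.

Lemma definable_const c : definable (fun _ => c).
Proof. now exists (Var 0), [c]. Qed.

Lemma definable_var i : definable (fun e => e i).
Proof. now exists (Var i), []. Qed.

(** Absorbs the shift of the environment that [tail] causes in terms standing under a bounded
    quantifier. *)
Lemma definable_rename t g : definable t -> definable (fun e => t (fun i => e (g i))).
Proof.
  intros (u & l & H). destruct (prepend_rename (X := dom M) l g) as [g' Hg].
  exists (tsubst (fun i => Var (g' i)) u), l. intro e.
  rewrite eval_tsubst, <- H. f_equal. extensionality i. apply Hg.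
Qed.

Lemma definable_plus s t : definable s -> definable t -> definable (fun e => plus (s e) (t e)).
Proof.
  intros Hs Ht. destruct (definable_pair s t Hs Ht) as (u & v & l & H).
  exists (Plus u v), l. intro e. simpl. now destruct (H e) as [-> ->].
Qed.

Lemma definable_times s t : definable s -> definable t -> definable (fun e => times (s e) (t e)).
Proof.
  intros Hs Ht. destruct (definable_pair s t Hs Ht) as (u & v & l & H).
  exists (Times u v), l. intro e. simpl. now destruct (H e) as [-> ->].
Qed.

Lemma definable_power s t : definable s -> definable t -> definable (fun e => power (s e) (t e)).
Proof.
  intros Hs Ht. destruct (definable_pair s t Hs Ht) as (u & v & l & H).
  exists (Exp u v), l. intro e. simpl. now destruct (H e) as [-> ->].
Qed.

Context (M_axiom : forall A, RCA0star A -> forall e E, sat (M := M) e E A).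

(* Renames a defining formula so that its variable 0 is the argument and the others
   are parameters, as the schemes of RCA0star require. *)
Lemma Delta0_unary (P : dom M -> Prop) : Delta0 (fun e => P (e 0)) ->
  exists A e E, Sigma00 A /\ forall x, sat (scons x e) E A <-> P x.
Proof.
  intros (A & l & L & HA & H). destruct (prepend_scons l) as [g Hg].
  exists (subst (fun i => Var (g i)) A), (prepend l (fun _ => zero)), (prepend L E0).
  split; [now apply Sigma00_subst|]. intro x. rewrite sat_subst, <- (H (scons x (fun _ => zero))).
  apply sat_ext; [apply Hg|easy].
Qed.

Lemma Delta0_induction (P : dom M -> Prop) : Delta0 (fun e => P (e 0)) ->
  P zero -> (forall x, P x -> P (plus x one)) -> forall x, P x.
Proof.
  intros HP H0 HS. destruct (Delta0_unary P HP) as (A & e & E & HA & H).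
  generalize (M_axiom _ (ax_induction A HA) e E). unfold induction_axiom.
  intros Hind x. apply H. apply Hind. clear Hind x. apply sat_and. split.
  - apply sat_subst. apply H in H0. revert H0. apply sat_ext; [|easy]. now intros [|i].
  - intros x Hx. apply H, HS, H in Hx. apply sat_subst. revert Hx.
    apply sat_ext; [|easy]. now intros [|i].
Qed.

(** A Sigma00 formula becomes both Sigma01 and Pi01 by a vacuous quantifier, so it can be used on
    both sides of the comprehension axiom. *)
Lemma Delta0_comprehension (P : dom M -> Prop) : Delta0 (fun e => P (e 0)) ->
  exists X : sets M, forall x, mem x X <-> P x.
Proof.
  intro HP. destruct (Delta0_unary P HP) as (A & e & E & HA & H).
  assert (Hs : forall x y, sat (scons y (scons x e)) E
                 (subst (fun i => Var (S i)) A) <-> P x).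
  { intros x y. rewrite sat_subst. apply H. }
  assert (Hax : RCA0star (comprehension_axiom (Ex (shift A)) (All (shift A)))).
  { apply ax_comprehension; eexists; (split; [|reflexivity]);
      apply Sigma00_subst; exact HA. }
  generalize (M_axiom _ Hax e E). unfold comprehension_axiom. intro HC.
  assert (HX : sat e E (ExS (All (Iff (Mem (Var 0) 0) (shiftS (Ex (shift A))))))).
  { apply HC. intro x. apply sat_iff. rewrite sat_ex. simpl. split.
    - intros [y Hy] z. apply Hs. apply Hs in Hy. exact Hy.
    - intro Hy. exists zero. apply Hs. apply (Hs x zero), Hy. }
  apply sat_exS in HX. destruct HX as [X HX]. exists X. intro x.
  specialize (HX x). apply sat_iff in HX. unfold shiftS in HX.
  rewrite sat_srename, sat_ex in HX. simpl in HX. rewrite HX. split.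
  - intros [y Hy]. now apply Hs in Hy.
  - intro Hx. exists zero. now apply Hs.
Qed.

End Definability.

(** * Arithmetic in a model of RCA0star *)

Declare Scope dom_scope.
Delimit Scope dom_scope with dom.
Bind Scope dom_scope with dom.
Notation "0" := zero : dom_scope.
Notation "1" := one : dom_scope.
Notation "x + y" := (plus x y) : dom_scope.
Notation "x * y" := (times x y) : dom_scope.
Notation "x ^ y" := (power x y) : dom_scope.
Notation "x < y" := (lt x y) : dom_scope.

Definition le {M : structure} (x y : dom M) : Prop := lt x y \/ x = y.
Notation "x <= y" := (le x y) : dom_scope.

Section Arithmetic.
Context {M : structure} (M_axiom : forall A, RCA0star A -> forall e E, sat (M := M) e E A).
Context (E0 : nat -> sets M).
Local Open Scope dom_scope.
Implicit Types a b c d i j k l m n p q r w x y z : dom M.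

Let val x y : nat -> dom M := scons x (fun _ => y).

Lemma succ_neq_0 x : x + 1 <> 0.
Proof. exact (M_axiom _ ax_succ_nonzero (val x 0) E0). Qed.

Lemma succ_inj x y : x + 1 = y + 1 -> x = y.
Proof. exact (M_axiom _ ax_succ_inj (val x y) E0). Qed.

Lemma plus_0_r x : x + 0 = x.
Proof. exact (M_axiom _ ax_add_zero (val x 0) E0). Qed.

Lemma plus_succ_r x y : x + (y + 1) = (x + y) + 1.
Proof. exact (M_axiom _ ax_add_succ (val x y) E0). Qed.

Lemma times_0_r x : x * 0 = 0.
Proof. exact (M_axiom _ ax_mul_zero (val x 0) E0). Qed.

Lemma times_succ_r x y : x * (y + 1) = x * y + x.
Proof. exact (M_axiom _ ax_mul_succ (val x y) E0). Qed.

Lemma lt_0_r x : ~ x < 0.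
Proof. exact (M_axiom _ ax_lt_zero (val x 0) E0). Qed.

Lemma lt_succ_r x y : x < y + 1 <-> x <= y.
Proof.
  generalize (M_axiom _ ax_lt_succ (val x y) E0). rewrite sat_iff, sat_or. auto.
Qed.

Lemma power_0_r x : x ^ 0 = 1.
Proof. exact (M_axiom _ ax_exp_zero (val x 0) E0). Qed.

Lemma power_succ_r x y : x ^ (y + 1) = x * x ^ y.
Proof. exact (M_axiom _ ax_exp_succ (val x y) E0). Qed.

Lemma Delta0_ball_le t (Q : (nat -> dom M) -> dom M -> Prop) :
  definable t -> Delta0 E0 (fun e => Q (tail e) (e O)) ->
  Delta0 E0 (fun e => forall x, x <= t e -> Q e x).
Proof.
  intros Ht HQ. apply Delta0_ext with (fun e => forall x, x < t e + 1 -> Q e x).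
  - intro e. split; intros H x Hx; apply H, lt_succ_r, Hx.
  - apply Delta0_ball; [|exact HQ]. apply definable_plus; [exact Ht|apply definable_const].
Qed.

Lemma Delta0_bex_le t (Q : (nat -> dom M) -> dom M -> Prop) :
  definable t -> Delta0 E0 (fun e => Q (tail e) (e O)) ->
  Delta0 E0 (fun e => exists x, x <= t e /\ Q e x).
Proof.
  intros Ht HQ. apply Delta0_ext with (fun e => exists x, x < t e + 1 /\ Q e x).
  - intro e. split; intros (x & Hx & H); exists x; (split; [apply lt_succ_r, Hx|exact H]).
  - apply Delta0_bex; [|exact HQ]. apply definable_plus; [exact Ht|apply definable_const].
Qed.

(* [apply] unifies up to unfolding of definitions, so relations defined from bounded
   quantifiers and terms need no closure lemma of their own. *)
Ltac delta0 :=
  intros; unfold tail;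
  repeat first
    [ assumption
    | match goal with
      | H : forall t, definable t -> _ |- _ => apply H
      | H : forall s t, definable s -> _ |- _ => apply H
      end
    | apply definable_const | apply definable_plus | apply definable_times
    | apply definable_power | apply definable_var
    | apply Delta0_ball_le | apply Delta0_bex_le
    | apply Delta0_eq | apply Delta0_lt | apply Delta0_mem
    | apply Delta0_and | apply Delta0_or | apply Delta0_not | apply Delta0_imp
    | apply Delta0_ball | apply Delta0_bex | apply definable_rename | progress unfold tail ].

Ltac induct x := revert x;
  match goal with |- forall z, @?P z =>
    apply (Delta0_induction E0 M_axiom P); cbv beta; [delta0| |] end.

Lemma plus_0_l x : 0 + x = x.
Proof.
  induct x; [apply plus_0_r|]. intros x IH. now rewrite plus_succ_r, IH.
Qed.

Lemma plus_assoc x y z : x + (y + z) = (x + y) + z.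
Proof.
  induct z; [now rewrite !plus_0_r|]. intros z IH. now rewrite !plus_succ_r, IH.
Qed.

Lemma plus_succ_l x y : (x + 1) + y = (x + y) + 1.
Proof.
  induct y; [now rewrite !plus_0_r|]. intros y IH. now rewrite !plus_succ_r, IH.
Qed.

Lemma plus_comm x y : x + y = y + x.
Proof.
  induct y; [now rewrite plus_0_r, plus_0_l|]. intros y IH.
  now rewrite plus_succ_r, plus_succ_l, IH.
Qed.

Lemma times_0_l x : 0 * x = 0.
Proof.
  induct x; [apply times_0_r|]. intros x IH. now rewrite times_succ_r, IH, plus_0_r.
Qed.

Lemma times_succ_l x y : (x + 1) * y = x * y + y.
Proof.
  induct y; [now rewrite !times_0_r, plus_0_r|]. intros y IH.
  now rewrite !times_succ_r, IH, !plus_succ_r, <- (plus_assoc _ x y), (plus_comm x y),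
    plus_assoc.
Qed.

Lemma times_comm x y : x * y = y * x.
Proof.
  induct y; [now rewrite times_0_r, times_0_l|]. intros y IH.
  now rewrite times_succ_r, times_succ_l, IH.
Qed.

Lemma times_plus_distr_l x y z : x * (y + z) = x * y + x * z.
Proof.
  induct z; [now rewrite times_0_r, !plus_0_r|]. intros z IH.
  now rewrite plus_succ_r, !times_succ_r, IH, plus_assoc.
Qed.

Lemma times_assoc x y z : x * (y * z) = (x * y) * z.
Proof.
  induct z; [now rewrite !times_0_r|]. intros z IH.
  now rewrite !times_succ_r, times_plus_distr_l, IH.
Qed.

Lemma times_1_l x : 1 * x = x.
Proof. now rewrite <- (plus_0_l 1), times_succ_l, times_0_l, plus_0_l. Qed.

Lemma dom_semiring : semi_ring_theory (R := dom M) zero one plus times eq.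
Proof.
  split; auto using plus_0_l, plus_comm, plus_assoc, times_1_l, times_0_l, times_comm,
    times_assoc.
  intros x y z. now rewrite !(times_comm _ z), times_plus_distr_l.
Qed.

Add Ring dom_ring : dom_semiring.

Lemma plus_cancel_r x y z : x + z = y + z -> x = y.
Proof.
  induct z; [now rewrite !plus_0_r|]. intros z IH H.
  rewrite !plus_succ_r in H. now apply IH, succ_inj.
Qed.

Lemma lt_0_succ x : 0 < x + 1.
Proof.
  induct x; [now apply lt_succ_r; right|]. intros x IH. apply lt_succ_r. now left.
Qed.

Lemma lt_plus_succ x z : x < x + z + 1.
Proof.
  induct z.
  - apply lt_succ_r. right. now rewrite plus_0_r.
  - intros z IH. apply lt_succ_r. left. now rewrite plus_assoc.
Qed.

Lemma succ_lt_succ x y : x < y -> x + 1 < y + 1.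
Proof.
  induct y; [intro H; now apply lt_0_r in H|].
  intros y IH [H| ->]%lt_succ_r; apply lt_succ_r; [left; auto|now right].
Qed.

Lemma lt_exists x y : x < y <-> exists z, y = x + z + 1.
Proof.
  split; [|intros [z ->]; apply lt_plus_succ].
  (* Bounding the witness makes the induction formula Sigma00. *)
  enough (H : x < y -> exists z, z < y /\ y = x + z + 1) by firstorder.
  induct y; [intro H; now apply lt_0_r in H|].
  intros y IH [H| ->]%lt_succ_r.
  - destruct (IH H) as (z & Hz & Hy). exists (z + 1).
    split; [now apply succ_lt_succ|]. rewrite Hy at 1. ring.
  - exists 0. split; [apply lt_0_succ|ring].
Qed.

Lemma le_exists x y : x <= y <-> exists z, y = x + z.
Proof.
  rewrite <- lt_succ_r, lt_exists. split; intros [z H]; exists z.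
  - now apply succ_inj.
  - now rewrite H.
Qed.

Lemma succ_le x y : x + 1 <= y <-> x < y.
Proof.
  rewrite le_exists, lt_exists. split; intros [z ->]; exists z; ring.
Qed.

Lemma zero_or_succ x : x = 0 \/ exists y, x = y + 1.
Proof.
  enough (H : x = 0 \/ exists y, y < x /\ x = y + 1) by firstorder.
  induct x; [now left|]. intros x _. right. exists x. split; [|easy].
  apply lt_succ_r. now right.
Qed.

Lemma le_refl x : x <= x.
Proof. now right. Qed.

Lemma lt_le x y : x < y -> x <= y.
Proof. now left. Qed.

Lemma le_0_l x : 0 <= x.
Proof. apply le_exists. exists x. ring. Qed.

Lemma le_trans x y z : x <= y -> y <= z -> x <= z.
Proof.
  rewrite !le_exists. intros [u ->] [v ->]. exists (u + v). ring.
Qed.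

Lemma lt_le_trans x y z : x < y -> y <= z -> x < z.
Proof. rewrite <- !succ_le. apply le_trans. Qed.

Lemma le_lt_trans x y z : x <= y -> y < z -> x < z.
Proof.
  rewrite lt_exists, !le_exists, lt_exists. intros [u ->] [v ->]. exists (u + v). ring.
Qed.

Lemma lt_trans x y z : x < y -> y < z -> x < z.
Proof. intros H1 H2. exact (lt_le_trans _ _ _ H1 (lt_le _ _ H2)). Qed.

Lemma lt_irrefl x : ~ x < x.
Proof.
  rewrite lt_exists. intros [z H]. apply (succ_neq_0 z), (plus_cancel_r _ _ x).
  rewrite plus_0_l. rewrite H at 2. ring.
Qed.

Lemma lt_not_le x y : x < y -> ~ y <= x.
Proof. intros H1 H2. exact (lt_irrefl _ (lt_le_trans _ _ _ H1 H2)). Qed.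

Lemma lt_or_le x y : x < y \/ y <= x.
Proof.
  induct y; [right; apply le_0_l|]. intros y [H|[H| ->]].
  - left. apply lt_succ_r. now left.
  - right. now apply succ_le.
  - left. apply lt_succ_r. now right.
Qed.

Lemma le_antisym x y : x <= y -> y <= x -> x = y.
Proof.
  intros [H|H] H'; [|easy]. exfalso. now apply (lt_not_le _ _ H).
Qed.

Lemma lt_neq x y : x < y -> x <> y.
Proof. intros H ->. now apply lt_irrefl in H. Qed.

Lemma neq_lt x y : x <> y -> x < y \/ y < x.
Proof. intro H. destruct (lt_or_le x y) as [|[| ->]]; auto. contradiction. Qed.

Lemma not_lt x y : ~ x < y -> y <= x.
Proof. intro H. now destruct (lt_or_le x y). Qed.

Lemma pos_neq_0 x : 0 < x <-> x <> 0.
Proof.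
  split; [intros H ->; now apply lt_irrefl in H|].
  intro H. destruct (zero_or_succ x) as [|[y ->]]; [contradiction|apply lt_0_succ].
Qed.

Lemma times_le_mono_r x y z : x <= y -> x * z <= y * z.
Proof. rewrite !le_exists. intros [u ->]. exists (u * z). ring. Qed.

Lemma le_plus_l x y : x <= x + y.
Proof. apply le_exists. now exists y. Qed.

Lemma plus_le_mono x y z w : x <= y -> z <= w -> x + z <= y + w.
Proof.
  rewrite !le_exists. intros [u ->] [v ->]. exists (u + v). ring.
Qed.

Lemma lt_succ_diag x : x < x + 1.
Proof. apply lt_succ_r, le_refl. Qed.

Lemma le_times_pos x y : 0 < y -> x <= x * y.
Proof.
  rewrite lt_exists, le_exists. intros [z ->]. exists (x * z). ring.
Qed.

Lemma power_pos x y : 0 < x -> 0 < x ^ y.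
Proof.
  intro Hx. induct y.
  - rewrite power_0_r, <- (plus_0_l 1). apply lt_0_succ.
  - intros y IH. rewrite power_succ_r. apply (lt_le_trans _ _ _ Hx).
    now apply le_times_pos.
Qed.

Lemma power_plus x y z : x ^ (y + z) = x ^ y * x ^ z.
Proof.
  induct z; [rewrite plus_0_r, power_0_r; ring|]. intros z IH.
  rewrite plus_succ_r, !power_succ_r, IH. ring.
Qed.

Lemma least (P : dom M -> Prop) n :
  (forall t, definable t -> Delta0 E0 (fun e => P (t e))) -> P n ->
  exists m, m <= n /\ P m /\ forall j, j < m -> ~ P j.
Proof.
  intros HP Hn.
  (* Induction on the search bound: below n there is a least element of P or no element at all, and
     both alternatives are Sigma00. *)
  assert (H : forall n, (exists m, m < n /\ P m /\ forall j, j < m -> ~ P j) \/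
    forall j, j < n -> ~ P j).
  { clear n Hn. intro n. induct n; [right; intros j Hj; now apply lt_0_r in Hj|].
    intros n [(m & Hm & H)|H].
    - left. exists m. split; [|exact H]. now apply lt_succ_r, lt_le.
    - destruct (classic (P n)) as [Hn|Hn].
      + left. exists n. split; [apply lt_succ_diag|auto].
      + right. intros j [Hj| ->]%lt_succ_r; auto. }
  destruct (H (n + 1)) as [(m & Hm & H')|H'].
  - exists m. split; [now apply lt_succ_r|exact H'].
  - exfalso. exact (H' n (lt_succ_diag n) Hn).
Qed.

(** * Division, digits and the pigeonhole principle *)

Definition quot (n m q : dom M) : Prop := exists r, r < m /\ n = q * m + r.

Lemma plus_lt_mono_l x y z : y < z -> x + y < x + z.
Proof. rewrite !lt_exists. intros [u ->]. exists u. ring. Qed.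

Lemma quot_lt q q' m r r' : q < q' -> r < m -> q * m + r < q' * m + r'.
Proof.
  intros Hq Hr. apply lt_le_trans with (q * m + m); [now apply plus_lt_mono_l|].
  apply le_trans with ((q + 1) * m); [right; ring|].
  apply le_trans with (q' * m); [|apply le_plus_l].
  apply times_le_mono_r. now apply succ_le.
Qed.

Lemma quot_mono n n' m q q' : n <= n' -> quot n m q -> quot n' m q' -> q <= q'.
Proof.
  intros Hn (r & Hr & ->) (r' & Hr' & ->). apply not_lt. intro H.
  exact (lt_not_le _ _ (quot_lt q' q m r' r H Hr') Hn).
Qed.

Lemma quot_unique n m q q' : quot n m q -> quot n m q' -> q = q'.
Proof.
  intros H H'. apply le_antisym; eapply quot_mono; eauto using le_refl.
Qed.

Lemma quot_rem_unique q q' m r r' : r < m -> r' < m ->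
  q * m + r = q' * m + r' -> q = q' /\ r = r'.
Proof.
  intros Hr Hr' H.
  assert (q = q') as <- by (apply (quot_unique (q * m + r) m); [now exists r|now exists r']).
  split; [easy|]. apply plus_cancel_r with (q * m). now rewrite !(plus_comm _ (q * m)).
Qed.

Lemma quot_exists n m : 0 < m -> exists q, q <= n /\ quot n m q.
Proof.
  intro Hm. induct n.
  - exists 0. split; [apply le_refl|]. exists 0. split; [exact Hm|ring].
  - intros n (q & Hq & r & Hr & Hn).
    destruct (proj2 (succ_le r m) Hr) as [Hr'|Hr'].
    + exists q. split; [eapply le_trans; [exact Hq|apply le_plus_l]|].
      exists (r + 1). split; [exact Hr'|]. rewrite Hn at 1. ring.
    + exists (q + 1). split; [apply plus_le_mono; [exact Hq|apply le_refl]|].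
      exists 0. split; [exact Hm|]. rewrite Hn at 1. rewrite <- Hr'. ring.
Qed.

(** Position i counts from the least significant digit, at 0: the quotient of s by b^i has last
    digit d. The bound on q keeps the relation Sigma00. *)
Definition digit (s b i d : dom M) : Prop :=
  d < b /\ exists q, q <= s /\ quot s (b ^ i) (q * b + d).

Lemma lt_pos x y : x < y -> 0 < y.
Proof. apply le_lt_trans, le_0_l. Qed.

Lemma digit_intro q r s b i d :
  d < b -> r < b ^ i -> s = (q * b + d) * b ^ i + r -> digit s b i d.
Proof.
  intros Hd Hr ->. split; [exact Hd|]. exists q. split; [|now exists r].
  eapply le_trans; [|apply le_plus_l]. eapply le_trans; [|apply le_times_pos].
  - eapply le_trans; [|apply le_plus_l]. apply le_times_pos. now apply lt_pos in Hd.
  - apply power_pos. now apply lt_pos in Hd.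
Qed.

Lemma digit_unique s b i d d' : digit s b i d -> digit s b i d' -> d = d'.
Proof.
  intros (Hd & q & _ & Hq) (Hd' & q' & _ & Hq').
  exact (proj2 (quot_rem_unique _ _ _ _ _ Hd Hd' (quot_unique _ _ _ _ Hq Hq'))).
Qed.

Lemma digit_exists s b i : 0 < b -> exists d, digit s b i d.
Proof.
  intro Hb. destruct (quot_exists s (b ^ i) (power_pos _ _ Hb)) as (p & _ & r & Hr & Hs).
  destruct (quot_exists p b Hb) as (q & _ & d & Hd & Hp).
  exists d. apply digit_intro with q r; [easy|easy|]. now rewrite <- Hp.
Qed.

Lemma digit_append s b n d : s < b ^ n -> d < b ->
  exists s', s' < b ^ (n + 1) /\ digit s' b n d /\
    forall i d', i < n -> digit s b i d' -> digit s' b i d'.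
Proof.
  intros Hs Hd. exists (d * b ^ n + s). split; [|split].
  - rewrite power_succ_r, <- (plus_0_r (b * _)). now apply quot_lt.
  - apply digit_intro with 0 s; [easy|easy|ring].
  - intros i d' [z ->]%lt_exists (Hd' & q & _ & r & Hr & ->).
    (* Here n = i + z + 1, so d * b^n contributes d * b^z to the part above position i and nothing
       at or below it. *)
    apply digit_intro with (q + d * b ^ z) r; [easy|easy|].
    rewrite <- plus_assoc, power_plus, power_succ_r. ring.
Qed.

(** A bounded form of choice that replaces recursion: the values are collected in one number, and s
    < b^n bounds the quantifier over codes in the induction on n. *)
Lemma digits_exist (F : dom M -> dom M -> Prop) b n :
  (forall s t, definable s -> definable t -> Delta0 E0 (fun e => F (s e) (t e))) ->
  (forall i, i < n -> exists d, d < b /\ F i d) ->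
  exists s, s < b ^ n /\ forall i, i < n -> exists d, d < b /\ digit s b i d /\ F i d.
Proof.
  intro HF. induct n.
  - intros _. exists 0. rewrite power_0_r. split; [rewrite <- (plus_0_l 1); apply lt_0_succ|].
    intros i Hi. now apply lt_0_r in Hi.
  - intros n IH H. destruct IH as (s & Hs & Hdig).
    { intros i Hi. apply H, lt_succ_r. now left. }
    destruct (H n (lt_succ_diag n)) as (d & Hd & Hnd).
    destruct (digit_append s b n d Hs Hd) as (s' & Hs' & Hn & Hold).
    exists s'. split; [exact Hs'|]. intros i [Hi| ->]%lt_succ_r.
    + destruct (Hdig i Hi) as (d' & Hd' & Hsi & Hi'). exists d'. auto.
    + exists d. auto.
Qed.

(** Maps from [0, m] to m are coded in a base b that stays fixed while m varies, so the quantifier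
    over codes is bounded and the usual induction on m goes through. *)
Lemma pigeonhole_digits b m : m <= b -> forall s, s < b ^ (m + 1) ->
  (forall i, i <= m -> exists d, d < m /\ digit s b i d) ->
  exists i, i <= m /\ exists j, j < i /\ exists d, d < m /\ digit s b j d /\ digit s b i d.
Proof.
  induct m.
  - intros _ s _ H. destruct (H 0 (le_refl 0)) as (d & Hd & _). now apply lt_0_r in Hd.
  - intros m IH Hmb s Hs H. apply NNPP. intro HN.
    assert (Hinj : forall i j d, i <= m + 1 -> j < i -> digit s b j d -> digit s b i d -> False).
    { intros i j d Hi Hj Hjd Hid. apply HN. exists i. split; [exact Hi|].
      exists j. split; [exact Hj|]. exists d. split; [|auto].
      destruct (H i Hi) as (d' & Hd' & Hid').
      now rewrite (digit_unique _ _ _ _ _ Hid Hid'). }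
    (* An index with value m takes over the value of the last index m + 1; this removes m from the
       range and m + 1 from the domain. *)
    set (F := fun i d => digit s b i d \/ digit s b i m /\ digit s b (m + 1) d).
    destruct (digits_exist (fun i d => d < m /\ F i d) b (m + 1)) as (s' & Hs' & Hdig).
    + unfold F. delta0.
    + intros i Hi%lt_succ_r.
      assert (Hlt : forall d, d < m -> d < b).
      { intros d Hd. eapply lt_le_trans; [exact Hd|]. apply lt_le, succ_le, Hmb. }
      assert (Hi1 : i < m + 1) by now apply lt_succ_r.
      destruct (H i (lt_le _ _ Hi1)) as (d & [Hd| ->]%lt_succ_r & Hid).
      * exists d. unfold F. auto.
      * destruct (H (m + 1) (le_refl _)) as (d & [Hd| ->]%lt_succ_r & Hmd).
        -- exists d. unfold F. auto.
        -- exfalso. eauto using le_refl.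
    + destruct (IH (lt_le _ _ (proj1 (succ_le _ _) Hmb)) s' Hs')
        as (i & Hi & j & Hj & d & Hd & Hjd & Hid).
      { intros i Hi%lt_succ_r. destruct (Hdig i Hi) as (d & _ & Hid & Hd & _). eauto. }
      assert (Hdig' : forall i, i <= m -> digit s' b i d -> F i d).
      { intros k Hk%lt_succ_r Hkd. destruct (Hdig k Hk) as (d' & _ & Hkd' & _ & HF).
        now rewrite (digit_unique _ _ _ _ _ Hkd Hkd'). }
      assert (Hi1 : i < m + 1) by now apply lt_succ_r.
      assert (Hj1 : j < m + 1) by exact (lt_trans _ _ _ Hj Hi1).
      (* A collision of the new map at j < i yields a collision of s at two of the indices j, i, m +
         1. *)
      destruct (Hdig' i Hi Hid) as [Hi'|[Hi' Him]],
               (Hdig' j (proj1 (lt_succ_r _ _) Hj1) Hjd) as [Hj'|[Hj' Hjm]];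
        eauto using lt_le, le_refl.
Qed.

Lemma pigeonhole (F : dom M -> dom M -> Prop) m :
  (forall s t, definable s -> definable t -> Delta0 E0 (fun e => F (s e) (t e))) ->
  (forall i, i <= m -> exists d, d < m /\ F i d) ->
  exists i j d, i <= m /\ j < i /\ F j d /\ F i d.
Proof.
  intros HF H. destruct (digits_exist F m (m + 1) HF) as (s & Hs & Hdig).
  { intros i Hi. now apply H, lt_succ_r. }
  destruct (pigeonhole_digits m m (le_refl m) s Hs) as (i & Hi & j & Hj & d & _ & Hjd & Hid).
  { intros i Hi%lt_succ_r. destruct (Hdig i Hi) as (d & Hd & Hid & _). eauto. }
  assert (Hdig' : forall k, k <= m -> digit s m k d -> F k d).
  { intros k Hk%lt_succ_r Hkd. destruct (Hdig k Hk) as (d' & _ & Hkd' & HFk).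
    now rewrite (digit_unique _ _ _ _ _ Hkd Hkd'). }
  exists i, j, d. repeat split; auto.
  apply Hdig'; [|exact Hjd]. now apply lt_le, (lt_le_trans _ _ _ Hj).
Qed.

Lemma greatest (P : dom M -> Prop) n :
  (forall t, definable t -> Delta0 E0 (fun e => P (t e))) -> P 0 -> 0 < n ->
  exists m, m < n /\ P m /\ forall j, j < n -> m < j -> ~ P j.
Proof.
  intros HP H0. induct n; [intro H; now apply lt_irrefl in H|].
  intros n IH _. destruct (classic (P n)) as [Hn|Hn].
  - exists n. split; [apply lt_succ_diag|]. split; [exact Hn|].
    intros j Hj%lt_succ_r Hnj. exfalso. now apply (lt_not_le _ _ Hnj).
  - destruct IH as (m & Hm & HPm & H); [apply pos_neq_0; now intros ->|].
    exists m. split; [now apply lt_succ_r, lt_le|]. split; [exact HPm|].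
    intros j [Hj| ->]%lt_succ_r Hmj; auto.
Qed.

Definition pair (x y : dom M) : dom M := (x + y) * (x + y) + x.

(** With s = x + y the pair lies in the interval [s^2, (s + 1)^2), so pairs with different sums are
    ordered by their sums. *)
Lemma pair_lt x y x' y' : x + y < x' + y' -> pair x y < pair x' y'.
Proof.
  unfold pair. intro H. apply lt_le_trans with ((x' + y') * (x' + y')); [|apply le_plus_l].
  apply lt_exists in H as [z ->]. apply lt_exists.
  (* This is (x + y + z + 1)^2 - ((x + y)^2 + x) - 1. *)
  exists ((1 + 1) * (x * z + y * z + y + z) + x + z * z). ring.
Qed.

Lemma pair_inj x y x' y' : pair x y = pair x' y' -> x = x' /\ y = y'.
Proof.
  intro H. assert (Hs : x + y = x' + y').
  { apply NNPP. intros [Hs|Hs]%neq_lt; apply pair_lt, lt_neq in Hs; auto. }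
  unfold pair in H. rewrite Hs, !(plus_comm (_ * _)) in H. apply plus_cancel_r in H as <-.
  split; [easy|]. apply plus_cancel_r with x. now rewrite !(plus_comm _ x).
Qed.

(** * Colorings and weakly homogeneous sets *)

(** This and the next three definitions copy the formulas conjunct by conjunct, so that translating
    satisfaction is purely syntactic. *)
Definition is_coloring (C : sets M) (R c : dom M) : Prop :=
  (forall z, mem z C -> exists x y k, x < y /\ y <= R /\ k < c /\ z = pair (pair x y) k) /\
  (forall x y, x < y /\ y <= R -> exists k, mem (pair (pair x y) k) C) /\
  (forall x y k k', mem (pair (pair x y) k) C /\ mem (pair (pair x y) k') C -> k = k').

Definition is_enumeration (h H : sets M) (n : dom M) : Prop :=
  (forall z, mem z h -> exists i x, i < n /\ mem x H /\ z = pair i x) /\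
  (forall i, i < n -> exists x, mem (pair i x) h) /\
  (forall i x y, mem (pair i x) h /\ mem (pair i y) h -> x = y) /\
  (forall x, mem x H -> exists i, mem (pair i x) h) /\
  (forall i j x y, i < j /\ mem (pair i x) h /\ mem (pair j y) h -> x < y).

Definition is_weakly_homogeneous (C h : sets M) : Prop :=
  forall i x y z,
    mem (pair i x) h /\ mem (pair (i + 1) y) h /\ mem (pair (i + 1 + 1) z) h ->
    exists k, mem (pair (pair x y) k) C /\ mem (pair (pair y z) k) C.

Definition has_weak_ramsey (R c a : dom M) : Prop :=
  forall C, is_coloring C R c ->
  exists H h, (forall x, mem x H -> x <= R) /\ is_enumeration h H (a + 1) /\
    is_weakly_homogeneous C h.

Lemma coloring_spec C R c x y k : is_coloring C R c ->
  mem (pair (pair x y) k) C -> x < y /\ y <= R /\ k < c.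
Proof.
  intros (HC & _) H. destruct (HC _ H) as (x' & y' & k' & Hxy & Hy & Hk & Heq).
  apply pair_inj in Heq as [Heq ->]. apply pair_inj in Heq as [-> ->]. auto.
Qed.

(* s codes, in base R+1, the vertices of a path of length l in color k. *)
Definition codes_path (C : sets M) (R k l s : dom M) : Prop :=
  forall i, i < l -> exists x, x <= R /\ exists y, y <= R /\
    digit s (R + 1) i x /\ digit s (R + 1) (i + 1) y /\ mem (pair (pair x y) k) C.

(** A path with l edges has l + 1 vertices, hence the exponent; the bound on s makes the existence
    of a path Sigma00. *)
Definition path (C : sets M) (R k l n : dom M) : Prop :=
  exists s, s < (R + 1) ^ (l + 1) /\ digit s (R + 1) l n /\ codes_path C R k l s.

Lemma path_0 C R k n : n <= R -> path C R k 0 n.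
Proof.
  intro Hn. assert (H0 : 0 < (R + 1) ^ 0) by apply power_pos, lt_0_succ.
  destruct (digit_append 0 (R + 1) 0 n H0) as (s & Hs & Hn' & _); [now apply lt_succ_r|].
  exists s. split; [exact Hs|]. split; [exact Hn'|]. intros i Hi. now apply lt_0_r in Hi.
Qed.

Lemma path_step C R c k l n m : is_coloring C R c ->
  path C R k l n -> mem (pair (pair n m) k) C -> path C R k (l + 1) m.
Proof.
  intros HC (s & Hs & Hn & Hpath) Hnm.
  destruct (coloring_spec _ _ _ _ _ _ HC Hnm) as (Hlt & HmR & _).
  destruct (digit_append s (R + 1) (l + 1) m Hs) as (s' & Hs' & Hm & Hold);
    [now apply lt_succ_r|].
  exists s'. split; [exact Hs'|]. split; [exact Hm|].
  intros i [Hi| ->]%lt_succ_r.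
  - destruct (Hpath i Hi) as (x & Hx & y & Hy & Hix & Hiy & Hxy).
    exists x. split; [exact Hx|]. exists y. split; [exact Hy|].
    split; [|split; [|exact Hxy]]; apply Hold; auto.
    + now apply lt_succ_r, lt_le.
    + now apply succ_lt_succ.
  - exists n. split; [now apply lt_le, (lt_le_trans _ m)|]. exists m. split; [exact HmR|].
    split; [|auto]. apply Hold; [apply lt_succ_diag|exact Hn].
Qed.

(* Otherwise sending n to the vector of the lengths of the longest paths of each color
   ending at n would inject [0, a^c] into a^c. *)
Lemma long_path_exists C a c : is_coloring C (a ^ c) c ->
  exists k n, path C (a ^ c) k a n.
Proof.
  intro HC. set (R := a ^ c) in *. apply NNPP. intro HN.
  (* Maximality among lengths below a suffices, since [HN] excludes length a, and it keeps the
     quantifier bounded. *)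
  set (longest := fun k n l => path C R k l n /\
                    forall l', l' < a -> l < l' -> ~ path C R k l' n).
  set (vector := fun n s => forall k, k < c ->
                   exists l, l < a /\ digit s a k l /\ longest k n l).
  (* For a = 0 a path with a edges is a single vertex. *)
  assert (Ha : 0 < a).
  { apply pos_neq_0. intro Ha. apply HN. exists 0, 0. rewrite Ha. apply path_0, le_0_l. }
  destruct (pigeonhole vector R) as (i & j & s & HiR & Hji & Hj & Hi).
  - unfold vector, longest. delta0.
  - intros n Hn. apply (digits_exist (fun k l => longest k n l) a c).
    + unfold longest. delta0.
    + intros k _. apply (greatest (fun l => path C R k l n) a); [delta0| |exact Ha].
      now apply path_0.
  - destruct (proj1 (proj2 HC) j i (conj Hji HiR)) as [k Hk].
    destruct (coloring_spec _ _ _ _ _ _ HC Hk) as (_ & _ & Hkc).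
    destruct (Hj k Hkc) as (l & Hl & Hsl & Hpath & _).
    destruct (Hi k Hkc) as (l' & _ & Hsl' & _ & Hmax).
    rewrite <- (digit_unique _ _ _ _ _ Hsl Hsl') in Hmax.
    pose proof (path_step _ _ _ _ _ _ _ HC Hpath Hk) as Hstep.
    (* The longest paths to j and i have equal length l, yet the edge extends the one to j: if l + 1
       < a this beats the maximum at i, and if l + 1 = a it contradicts [HN]. *)
    apply succ_le in Hl. destruct Hl as [Hl|Hl].
    + exact (Hmax _ Hl (lt_succ_diag l) Hstep).
    + apply HN. exists k, i. now rewrite <- Hl.
Qed.

Lemma codes_path_mem C R c k l s i x y : is_coloring C R c -> codes_path C R k l s ->
  i < l -> digit s (R + 1) i x -> digit s (R + 1) (i + 1) y -> mem (pair (pair x y) k) C.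
Proof.
  intros HC Hpath Hi Hx Hy.
  destruct (Hpath i Hi) as (x' & _ & y' & _ & Hx' & Hy' & H).
  now rewrite (digit_unique _ _ _ _ _ Hx Hx'), (digit_unique _ _ _ _ _ Hy Hy').
Qed.

Lemma codes_path_increasing C R c k l s i j x y :
  is_coloring C R c -> codes_path C R k l s ->
  i < j -> j <= l -> digit s (R + 1) i x -> digit s (R + 1) j y -> x < y.
Proof.
  intros HC Hpath Hij Hj Hx Hy.
  (* The bound on y makes the statement Sigma00 for the induction on j. *)
  enough (H : j <= l -> i < j -> forall y, y <= R -> digit s (R + 1) j y -> x < y).
  { apply H; auto. apply lt_succ_r, Hy. }
  clear Hij Hj Hy y. induct j; [intros _ H; now apply lt_0_r in H|].
  intros j IH Hj%succ_le Hij y _ Hy.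
  destruct (digit_exists s (R + 1) j (lt_0_succ R)) as [z Hz].
  assert (Hzy : z < y).
  { apply (coloring_spec C R c z y k HC). eapply codes_path_mem; eauto. }
  apply lt_succ_r in Hij. destruct Hij as [Hij| ->].
  - apply lt_trans with z; [|exact Hzy]. apply IH; auto using lt_le. apply lt_succ_r, Hz.
  - now rewrite (digit_unique _ _ _ _ _ Hx Hz).
Qed.

(** Once the code s of a long path is a parameter, being digit i of s is Sigma00, so comprehension
    yields the vertex set and its enumeration. *)
Lemma weak_ramsey_upper a c : has_weak_ramsey (a ^ c) c a.
Proof.
  intros C HC. destruct (long_path_exists C a c HC) as (k & n & s & _ & _ & Hpath).
  set (R := a ^ c) in *.
  assert (HR : forall i x, digit s (R + 1) i x -> x <= R)
    by (intros i x H; apply lt_succ_r, H).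
  destruct (Delta0_comprehension E0 M_axiom (fun x => exists i, i <= a /\ digit s (R + 1) i x))
    as [H HH]; [delta0|].
  destruct (Delta0_comprehension E0 M_axiom (fun z => exists i, i <= a /\ exists x, x <= R /\
    digit s (R + 1) i x /\ z = pair i x)) as [h Hh]; [delta0|].
  assert (Hpair : forall i x, mem (pair i x) h <-> i <= a /\ digit s (R + 1) i x).
  { intros i x. rewrite Hh. split.
    - intros (i' & Hi & x' & _ & Hx & [-> ->]%pair_inj). auto.
    - intros [Hi Hx]. eauto 8. }
  exists H, h. split; [|split].
  - intros x (i & _ & Hx)%HH. eauto.
  - repeat split.
    + intros z (i & Hi & x & _ & Hx & ->)%Hh. exists i, x. split; [now apply lt_succ_r|].
      split; [|easy]. apply HH. eauto.
    + intros i Hi%lt_succ_r. destruct (digit_exists s (R + 1) i (lt_0_succ R)) as [x Hx].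
      exists x. now apply Hpair.
    + intros i x y [[_ Hx]%Hpair [_ Hy]%Hpair]. eauto using digit_unique.
    + intros x (i & Hi & Hx)%HH. exists i. now apply Hpair.
    + intros i j x y (Hij & [Hi Hx]%Hpair & [Hj Hy]%Hpair).
      eapply codes_path_increasing; eauto.
  - intros i x y z ([_ Hx]%Hpair & [Hi Hy]%Hpair & [Hi' Hz]%Hpair).
    exists k. split; eapply codes_path_mem; eauto; now apply succ_le.
Qed.

(** x and y agree in all base a digits from position j upwards. *)
Definition same_quot (a x y j : dom M) : Prop :=
  exists q, q <= x /\ quot x (a ^ j) q /\ quot y (a ^ j) q.

(* k is the position of the most significant base a digit at which x and y differ. *)
Definition top_difference (a x y k : dom M) : Prop :=
  same_quot a x y (k + 1) /\ forall j, j < k + 1 -> ~ same_quot a x y j.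

Lemma same_quot_0 a x y : same_quot a x y 0 -> x = y.
Proof.
  intros (q & _ & (r & Hr & ->) & (r' & Hr' & ->)).
  rewrite power_0_r, <- (plus_0_l 1) in *.
  destruct (proj1 (lt_succ_r _ _) Hr) as [H| ->]; [now apply lt_0_r in H|].
  destruct (proj1 (lt_succ_r _ _) Hr') as [H| ->]; [now apply lt_0_r in H|]. easy.
Qed.

Lemma quot_0 n m : n < m -> quot n m 0.
Proof. intro H. exists n. split; [exact H|ring]. Qed.

Lemma top_difference_exists a c x y : x < y -> y < a ^ c ->
  exists k, k < c /\ top_difference a x y k.
Proof.
  intros Hxy Hy.
  (* At c both quotients are 0, so agreement does occur; its least position is positive because x
     and y differ, and k is the predecessor. *)
  destruct (least (same_quot a x y) c) as (j & Hj & Hsame & Hmin).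
  - delta0.
  - exists 0. split; [apply le_0_l|].
    split; apply quot_0; [exact (lt_trans _ _ _ Hxy Hy)|exact Hy].
  - destruct (zero_or_succ j) as [->|[k ->]].
    + apply same_quot_0 in Hsame as ->. now apply lt_irrefl in Hxy.
    + exists k. split; [now apply succ_le|]. now split.
Qed.

Lemma top_difference_unique a x y k k' :
  top_difference a x y k -> top_difference a x y k' -> k = k'.
Proof.
  intros [H1 H2] [H1' H2']. apply NNPP.
  intros [H|H]%neq_lt; apply succ_lt_succ in H; [now apply (H2' _ H)|now apply (H2 _ H)].
Qed.

(** Quotients are monotone, and equal quotients by a^k would mean agreement already from position
    k. *)
Lemma top_difference_quot a x y k p q : 0 < a -> x < y -> top_difference a x y k ->
  quot x (a ^ k) p -> quot y (a ^ k) q -> p < q.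
Proof.
  intros Ha Hxy [_ Hne] Hp Hq.
  destruct (quot_mono _ _ _ _ _ (lt_le _ _ Hxy) Hp Hq) as [H| <-]; [exact H|].
  exfalso. apply (Hne k (lt_succ_diag k)). exists p. split; [|auto].
  destruct Hp as (r & _ & ->). eapply le_trans; [|apply le_plus_l].
  apply le_times_pos. now apply power_pos.
Qed.

Lemma top_difference_coloring a c w : w < a ^ c ->
  exists C, is_coloring C w c /\
    forall x y k, mem (pair (pair x y) k) C -> top_difference a x y k.
Proof.
  intro Hw.
  destruct (Delta0_comprehension E0 M_axiom (fun z => exists x, x <= w /\ exists y, y <= w /\
    exists k, k < c /\ x < y /\ top_difference a x y k /\ z = pair (pair x y) k)) as [C HC].
  { delta0. }
  assert (Htop : forall x y k, mem (pair (pair x y) k) C -> top_difference a x y k).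
  { intros x y k (x' & _ & y' & _ & k' & _ & _ & H & [Heq ->]%pair_inj)%HC.
    now apply pair_inj in Heq as [-> ->]. }
  exists C. split; [|exact Htop]. repeat split.
  - intros z (x & _ & y & Hy & k & Hk & Hxy & _ & ->)%HC. exists x, y, k. auto.
  - intros x y [Hxy Hy].
    destruct (top_difference_exists a c x y Hxy (le_lt_trans _ _ _ Hy Hw)) as (k & Hk & H).
    exists k. apply HC. exists x. split; [exact (lt_le _ _ (lt_le_trans _ _ _ Hxy Hy))|].
    exists y. split; [exact Hy|]. exists k. auto.
  - intros x y k k' [H H']. eauto using top_difference_unique.
Qed.

(** Weak homogeneity compares consecutive edges only; induction carries the color of the first edge,
    present because a > 0, along h. The bounds x, y <= R make the induction formula Sigma00. *)
Lemma weakly_homogeneous_color C R c H h a : is_coloring C R c ->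
  (forall x, mem x H -> x <= R) -> is_enumeration h H (a + 1) ->
  is_weakly_homogeneous C h -> 0 < a ->
  exists k, forall i, i < a -> forall x, x <= R -> forall y, y <= R ->
    mem (pair i x) h -> mem (pair (i + 1) y) h -> mem (pair (pair x y) k) C.
Proof.
  intros HC HR (Hdom & Htot & Hfun & _ & Hinc) Hwh Ha.
  destruct (Htot 0 (lt_0_succ a)) as [x0 Hx0].
  destruct (Htot (0 + 1) (succ_lt_succ _ _ Ha)) as [x1 Hx1].
  assert (Hbound : forall i x, mem (pair i x) h -> x <= R).
  { intros i x Hix. destruct (Hdom _ Hix) as (i' & x' & _ & Hx' & [-> ->]%pair_inj). auto. }
  destruct (proj1 (proj2 HC) x0 x1) as [k Hk].
  { split; [|eauto]. apply (Hinc 0 (0 + 1)). split; [apply lt_succ_diag|auto]. }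
  exists k. intro i. induct i.
  - intros _ x _ y _ Hx Hy.
    now rewrite (Hfun 0 x x0 (conj Hx Hx0)), (Hfun (0 + 1) y x1 (conj Hy Hx1)).
  - intros i IH Hi y Hy z Hz Hiy Hiz.
    assert (Hia : i < a) by exact (lt_trans _ _ _ (lt_succ_diag i) Hi).
    destruct (Htot i) as [x Hx]; [now apply lt_succ_r, lt_le|].
    assert (Hxy : mem (pair (pair x y) k) C) by (apply IH; eauto).
    destruct (Hwh i x y z) as (k' & Hk1 & Hk2); [auto|].
    now rewrite (proj2 (proj2 HC) x y k k' (conj Hxy Hk1)).
Qed.

Lemma weak_ramsey_lower a c w : ~ (a = 0 /\ c = 0) -> w < a ^ c -> ~ has_weak_ramsey w c a.
Proof.
  intros Hac Hw Hram.
  assert (Ha : 0 < a).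
  (* For a = 0 the number c of colors is positive, so a^c = 0 and no w lies below it. *)
  { apply pos_neq_0. intros ->. destruct (zero_or_succ c) as [->|[d ->]]; [auto|].
    rewrite power_succ_r, times_0_l in Hw. now apply lt_0_r in Hw. }
  destruct (top_difference_coloring a c w Hw) as (C & HC & Htop).
  destruct (Hram C HC) as (H & h & HR & Henum & Hwh).
  destruct (weakly_homogeneous_color C w c H h a HC HR Henum Hwh Ha) as [k Hk].
  destruct Henum as (Hdom & Htot & Hfun & _ & Hinc).
  assert (Hbound : forall i x, mem (pair i x) h -> x <= w).
  { intros i x Hix. destruct (Hdom _ Hix) as (i' & x' & _ & Hx' & [-> ->]%pair_inj). auto. }
  destruct (Htot 0 (lt_0_succ a)) as [x0 Hx0].
  destruct (quot_exists x0 (a ^ (k + 1)) (power_pos _ _ Ha)) as (p & _ & Hp).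
  assert (Hgrow : forall i, i <= a -> forall x, x <= w -> mem (pair i x) h ->
    quot x (a ^ (k + 1)) p /\ exists q, q <= x /\ quot x (a ^ k) q /\ p * a + i <= q).
  { intro i. induct i.
    - intros _ x _ Hx. rewrite (Hfun 0 x x0 (conj Hx Hx0)). split; [exact Hp|].
      destruct (quot_exists x0 (a ^ k) (power_pos _ _ Ha)) as (q & Hq & Hxq).
      exists q. split; [exact Hq|]. split; [exact Hxq|]. rewrite plus_0_r.
      (* If q < p * a, then x0 < p * a * a^k = p * a^(k + 1) <= x0. *)
      apply not_lt. intro Hlt. destruct Hp as (r & _ & Hr), Hxq as (r' & Hr' & Hx0').
      apply (lt_irrefl x0). rewrite Hr at 2. rewrite Hx0', power_succ_r, times_assoc.
      now apply quot_lt.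
    - intros i IH Hi y Hy Hiy. apply succ_le in Hi.
      destruct (Htot i) as [x Hx]; [now apply lt_succ_r, lt_le|].
      assert (Hxw : x <= w) by eauto.
      destruct (IH (lt_le _ _ Hi) x Hxw Hx) as (Hxp & q & _ & Hxq & Hq).
      pose proof (Hk i Hi x Hxw y Hy Hx Hiy) as Hxy.
      pose proof (proj1 (coloring_spec _ _ _ _ _ _ HC Hxy)) as Hlt.
      pose proof (Htop _ _ _ Hxy) as Hd. split.
      + destruct Hd as [(p' & _ & Hxp' & Hyp') _].
        now rewrite (quot_unique _ _ _ _ Hxp Hxp').
      + destruct (quot_exists y (a ^ k) (power_pos _ _ Ha)) as (q' & Hq' & Hyq').
        exists q'. split; [exact Hq'|]. split; [exact Hyq'|].
        rewrite plus_assoc. apply succ_le. apply le_lt_trans with q; [exact Hq|].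
        exact (top_difference_quot a x y k q q' Ha Hlt Hd Hxq Hyq'). }
  destruct (Htot a (lt_succ_diag a)) as [x Hx].
  destruct (Hgrow a (le_refl a) x (Hbound _ _ Hx) Hx) as ((r & Hr & Hxr) & q & _ & Hq & Hpq).
  destruct Hq as (r' & _ & Hxr').
  (* At i = a the quotient by a^k is at least (p + 1) * a, so x >= (p + 1) * a^(k + 1), although its
     quotient by a^(k + 1) is p. *)
  apply (lt_irrefl x). rewrite Hxr at 1.
  apply lt_le_trans with ((p + 1) * a ^ (k + 1) + 0);
    [apply quot_lt; [apply lt_succ_diag|exact Hr]|].
  rewrite Hxr', power_succ_r. apply plus_le_mono; [|apply le_0_l].
  apply le_trans with ((p * a + a) * a ^ k); [right; ring|]. now apply times_le_mono_r.
Qed.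

Definition is_weak_ramsey_number (w c a : dom M) : Prop :=
  has_weak_ramsey w c a /\ forall v, v < w -> ~ has_weak_ramsey v c a.

Lemma weak_ramsey_number a c : ~ (a = 0 /\ c = 0) -> is_weak_ramsey_number (a ^ c) c a.
Proof.
  intro Hac. split; [apply weak_ramsey_upper|].
  intros v Hv. now apply weak_ramsey_lower.
Qed.

End Arithmetic.

(** * The arithmetized statement *)

Section Translation.
Context {M : structure}.
Implicit Types (e : nat -> dom M) (E : nat -> sets M).

Lemma sat_all_iff e E A (P : dom M -> Prop) :
  (forall x, sat (scons x e) E A <-> P x) -> (sat e E (All A) <-> forall x, P x).
Proof. firstorder. Qed.

Lemma sat_allS_iff e E A (P : sets M -> Prop) :
  (forall X, sat e (scons X E) A <-> P X) -> (sat e E (AllS A) <-> forall X, P X).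
Proof. firstorder. Qed.

Lemma sat_ex_iff e E A (P : dom M -> Prop) :
  (forall x, sat (scons x e) E A <-> P x) -> (sat e E (Ex A) <-> exists x, P x).
Proof. rewrite sat_ex. firstorder. Qed.

Lemma sat_exS_iff e E A (P : sets M -> Prop) :
  (forall X, sat e (scons X E) A <-> P X) -> (sat e E (ExS A) <-> exists X, P X).
Proof. rewrite sat_exS. firstorder. Qed.

Lemma sat_imp_iff e E A B (P Q : Prop) :
  (sat e E A <-> P) -> (sat e E B <-> Q) -> (sat e E (Imp A B) <-> (P -> Q)).
Proof. simpl. tauto. Qed.

Lemma sat_and_iff e E A B (P Q : Prop) :
  (sat e E A <-> P) -> (sat e E B <-> Q) -> (sat e E (And A B) <-> P /\ Q).
Proof. rewrite sat_and. tauto. Qed.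

Lemma sat_lesseq_iff e E s t x y : eval e s = x -> eval e t = y ->
  (sat e E (LessEq s t) <-> (x <= y)%dom).
Proof. intros <- <-. apply sat_lesseq. Qed.

(** The order matters: the derived connectives unfold to [Imp] and [All], so the rules for those two
    come last. *)
Ltac translate_step := first
  [ apply sat_and_iff | apply sat_ex_iff; intro | apply sat_exS_iff; intro
  | apply sat_lesseq_iff | apply sat_all_iff; intro | apply sat_allS_iff; intro
  | apply sat_imp_iff ].
Ltac translate := repeat translate_step; simpl; rewrite ?eval_lift; reflexivity.

Lemma sat_coloring e E C R c :
  sat e E (coloring C R c) <-> is_coloring (E C) (eval e R) (eval e c).
Proof. unfold coloring. translate. Qed.

Lemma sat_enumerates e E h H n :
  sat e E (enumerates h H n) <-> is_enumeration (E h) (E H) (eval e n).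
Proof. unfold enumerates. translate. Qed.

Lemma sat_weakly_homogeneous e E C h :
  sat e E (weakly_homogeneous C h) <-> is_weakly_homogeneous (E C) (E h).
Proof. unfold weakly_homogeneous. translate. Qed.

Lemma sat_weak_ramsey e E R c a :
  sat e E (weak_ramsey R c a) <-> has_weak_ramsey (eval e R) (eval e c) (eval e a).
Proof.
  apply sat_allS_iff. intro C. apply sat_imp_iff; [apply sat_coloring|].
  apply sat_exS_iff. intro H. apply sat_exS_iff. intro h.
  apply sat_and_iff; [|apply sat_and_iff; [apply sat_enumerates|apply sat_weakly_homogeneous]].
  translate.
Qed.

Lemma sat_is_wr e E w c a :
  sat e E (is_wr w c a) <-> is_weak_ramsey_number (eval e w) (eval e c) (eval e a).
Proof.
  apply sat_and_iff; [apply sat_weak_ramsey|]. apply sat_all_iff. intro v.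
  apply sat_imp_iff; [translate|]. apply sat_imp_iff; [|reflexivity].
  rewrite sat_weak_ramsey. now rewrite !eval_lift.
Qed.

End Translation.

Theorem theorem13 :
  proves RCA0star
    (All (All (~ (#1 = 0 /\ #0 = 0) -> is_wr (#1 ^ #0) #0 #1)))%fm.
Proof.
  apply completeness. intros M M_axiom e E a c. rewrite sat_imp, sat_neg, sat_and, sat_is_wr.
  exact (weak_ramsey_number M_axiom E a c).
Qed.
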